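(* In the setting of the context, let $P$ be a patch in a tiling in $\Omega_{punc}$ and let $t,t'$ be tiles in $P$. Then both $e(P,t,t')$ and $z$ are in $C_c(R_{punc})$. Moreover: (i) $e(P,t,t')^\ast=e(P,t',t)$; (ii) $z\cdot e(P,t,t')=e^{(\angle t-\angle t')i}\,(e(P,t,t')\cdot z)$; (iii) if $P_1,P_2$ are patches in tilings in $\Omega_{punc}$, $t_1,t_1'\in P_1$, $t_2,t_2'\in P_2$, $t_1'=t_2$, and $P_1,P_2$ agree where they intersect, then $$e(P_1,t_1,t_1')\cdot e(P_2,t_2,t_2')=e(P_1\cup P_2,t_1,t_2');$$ (iv) under the hypotheses of (iii) and for $k,l\in\mathbb{Z}$, $$(z^k\cdot e(P_1,t_1,t_1'))\cdot(z^l\cdot e(P_2,t_2,t_2'))=e^{l(\angle t_2-\angle t_1)i}\,\big(z^{k+l}\cdot e(P_1\cup P_2,t_1,t_2')\big).$$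
   Context: **Tilings.** A tiling of $\mathbb{R}^2$ is a countable collection of closed polygonal subsets (tiles) covering $\mathbb{R}^2$ such that distinct tiles have disjoint interiors. A patch in a tiling is a finite subset of its tiles; $T\cap B(x,r)$ denotes the patch of tiles of $T$ completely contained in the open ball $B(x,r)$. $\Gamma=\mathbb{R}^2\rtimes \mathcal{S}^1$ is the group of orientation preserving isometries of $\mathbb{R}^2$, where $\mathcal{S}^1=SO(2,\mathbb{R})$ consists of the rotations $R_\theta$ about the origin; $(x,R_\theta)\in\Gamma$ acts on a tiling $T$ by $R_\theta(T+x)$. Put $d((x,R_\theta),(y,R_\phi))=|x-y|+\|R_\theta-R_\phi\|_{F}$ (Frobenius norm of the matrix difference). **Tiling metric.** For $0<\varepsilon<1$, say $T,T'$ are within $\varepsilon$ if there are $(x,R_\theta),(x',R_{\theta'})\in\Gamma$, each at $d$-distance $<\varepsilon$ from the identity, with $R_\theta(T+x)\cap B(0,\varepsilon^{-1})=R_{\theta'}(T'+x')\cap B(0,\varepsilon^{-1})$. Then $d_\Gamma(T,T')$ is the infimum of all such $\varepsilon$, or $1$ if there are none. The continuous hull $\Omega_T$ of a tiling $T$ is the completion of $\{T+x:x\in\mathbb{R}^2\}$ in $d_\Gamma$; its elements are tilings. **Standing assumptions.** There is a finite set of proto-tiles $\{p_1,\dots,p_n\}$ (closed polygons, pairwise not related by elements of $\Gamma$) such that each tile of each tiling in $\Omega_T$ is $\gamma(p_i)$ for some $\gamma\in\Gamma$ and some $i$. $\Gamma$ is the full group of orientation preserving isometries, in the sense that for every $\gamma\in\Gamma$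 and proto-tile $p$ some tiling in $\Omega_T$ contains $\gamma(p)$, and $\Omega_T$ is invariant under rotations. $\Omega_T$ has finite local complexity with respect to $\Gamma$: for every $r>0$ the set $\{T'\cap B(x,r):T'\in\Omega_T,\ x\in\mathbb{R}^2\}$ is finite modulo $\Gamma$. $\Omega_T$ is strongly aperiodic: $T'+x\ne T'$ for all $T'\in\Omega_T$ and $x\neq 0$. **Punctures.** Each proto-tile $p_i$ has a chosen point $x(p_i)$ in its interior (its puncture) such that the pointed polygon $(p_i,x(p_i))$ has trivial symmetry group; proto-tiles are placed in a fixed orientation with $x(p_i)=0$. Every tile $t=\gamma(p_i)$ gets the puncture $x(t)=\gamma(x(p_i))$. For a tile $t=R_\theta(p_i)+v$ put $\angle t=\theta$ (mod $2\pi$). The discrete hull is $\Omega_{punc}=\{T'\in\Omega_T : \text{some tile } t\in T' \text{ has } x(t)=0\}$ with metric $d_\Gamma$; for $T'\in\Omega_{punc}$, $T'(0)$ is the tile of $T'$ containing the origin. **Equivalence relation.** $R_{punc}=\{(T',T'-x(t)):T'\in\Omega_{punc},\ t\in T'\}$ has the topology of the metric $d_R((T_1,T_1-x(t_1)),(T_2,T_2-x(t_2)))=d_\Gamma(T_1,T_2)+|x(t_1)-x(t_2)|$; $[T']$ is the equivalence class of $T'$. $C_c(R_{punc})$ (continuous compactly supported complex functions) is a $\ast$-algebra with $f\cdot g(T_1,T_2)=\sum_{T_3\in[T_1]}f(T_1,T_3)g(T_3,T_2)$ and $f^\ast(T_1,T_2)=\overline{f(T_2,T_1)}$. **The functions.**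 For a finite set $P$ of tiles and $t,t'\in P$, $e(P,t,t')$ is the characteristic function of $$V(P,t,t')=\{(T_1,T_1-R_\theta(x(t')-x(t)))\in R_{punc} : R_\theta(P-x(t))\subset T_1 \text{ for some } R_\theta\in\mathcal{S}^1\}$$ (it is the zero function if no tiling in $\Omega_{punc}$ contains a rotated copy of $P-x(t)$). The function $z$ is $z(T_1,T_2)=e^{i\angle T_1(0)}$ if $T_1=T_2$ and $0$ otherwise; $z^k$ ($k\in\mathbb{Z}$) is its $k$-th power (as a unitary). Patches $P_1,P_2$ ''agree where they intersect'' if distinct tiles of $P_1\cup P_2$ have disjoint interiors.
   Formalization: It is additionally assumed that the puncture x(t)=γ(x(p_i)) depends only on the tile t as a subset of the plane, i.e. no proto-tile has a nontrivial rotational symmetry; otherwise x(t) and the angle of t are not well defined. *)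

(* Defs.v *)
From HB Require Import structures.
From mathcomp Require Import all_boot all_order all_algebra.
From mathcomp Require Import all_classical all_reals all_analysis.
From mathcomp Require Import complex.
Set Implicit Arguments.
Unset Strict Implicit.
Unset Printing Implicit Defensive.
Import Order.TTheory GRing.Theory Num.Theory.
Import numFieldNormedType.Exports.
Local Open Scope classical_set_scope.
Local Open Scope ring_scope.
Local Open Scope complex_scope.

Definition plane (R : realType) : Type := 'cV[R]_2.
HB.instance Definition _ (R : realType) := NormedModule.on (plane R).

(* Collections of subsets of the plane: tilings and patches are elements. *)
Definition tiles (R : realType) : Type := set (set (plane R)).
HB.instance Definition _ (R : realType) := Choice.on (tiles R).

(* Frobenius norm; for a column vector it is the Euclidean norm (the norm
   `|v| of the library is the sup norm). *)
Definition fnorm (R : realType) (m n : nat) (A : 'M[R]_(m, n)) : R :=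
  Num.sqrt (\sum_i \sum_j A i j ^+ 2).

Definition eball (R : realType) (x : plane R) (r : R) : set (plane R) :=
  [set y | fnorm (y - x) < r].

Definition rot (R : realType) (theta : R) : 'M[R]_2 :=
  \matrix_(i < 2, j < 2)
    if i == j then cos theta
    else if i == ord0 then - sin theta else sin theta.

(* The pair (x, theta) stands for the isometry (x, R_theta) of the plane; the
   angle theta is only ever used through the matrix [rot theta]. *)
Definition isom (R : realType) : Type := (plane R * R)%type.

Definition isom1 (R : realType) : isom R := (0, 0).

Definition isom_dist (R : realType) (g h : isom R) : R :=
  fnorm (g.1 - h.1) + fnorm (rot g.2 - rot h.2).

Definition isom_act_pt (R : realType) (g : isom R) (y : plane R) : plane R :=
  rot g.2 *m (y + g.1).

Definition isom_act_set (R : realType) (g : isom R) (A : set (plane R)) :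
    set (plane R) :=
  isom_act_pt g @` A.

Definition isom_act (R : realType) (g : isom R) (T : tiles R) : tiles R :=
  isom_act_set g @` T.

Definition translate_set (R : realType) (v : plane R) (A : set (plane R)) :
    set (plane R) :=
  [set y + v | y in A].

Definition translate (R : realType) (v : plane R) (T : tiles R) : tiles R :=
  translate_set v @` T.

Definition rot_set (R : realType) (theta : R) (A : set (plane R)) :
    set (plane R) :=
  [set rot theta *m y | y in A].

Definition rotate (R : realType) (theta : R) (T : tiles R) : tiles R :=
  rot_set theta @` T.

Definition triangle (R : realType) (a b c : plane R) : set (plane R) :=
  [set y | exists s t u : R, [/\ 0 <= s, 0 <= t, 0 <= u, s + t + u = 1 &
                                 y = s *: a + t *: b + u *: c]].

(* A closed polygonal set: a nonempty finite union of nondegenerate closed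
   triangles. *)
Definition polygon (R : realType) (A : set (plane R)) : Prop :=
  exists s : seq (plane R * plane R * plane R),
    [/\ s <> [::],
        (forall a b c, (a, b, c) \in s ->
           \det (row_mx (b - a) (c - a) : 'M[R]_2) != 0) &
        A = [set y | exists a b c, (a, b, c) \in s /\ triangle a b c y]].

Definition disjoint_interiors (R : realType) (T : tiles R) : Prop :=
  forall s t, T s -> T t -> s <> t -> s^° `&` t^° = set0.

Definition tiling (R : realType) (T : tiles R) : Prop :=
  [/\ countable T,
      (forall t, T t -> polygon t),
      \bigcup_(t in T) t = setT &
      disjoint_interiors T].

Definition patch_in_ball (R : realType) (T : tiles R) (x : plane R) (r : R) :
    tiles R :=
  [set t | T t /\ t `<=` eball x r].

Definition eps_close (R : realType) (T T' : tiles R) (e : R) : Prop :=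
  [/\ 0 < e, e < 1 &
      exists g g' : isom R,
        [/\ isom_dist g (isom1 R) < e,
            isom_dist g' (isom1 R) < e &
            patch_in_ball (isom_act g T) 0 e^-1 = patch_in_ball (isom_act g' T') 0 e^-1]].

Definition dGamma (R : realType) (T T' : tiles R) : R :=
  if `[< exists e, eps_close T T' e >] then inf [set e | eps_close T T' e] else 1.

(* The completion of the translation orbit of T, realized as its closure for
   dGamma among the tilings of the plane. *)
Definition hull (R : realType) (T : tiles R) : set (tiles R) :=
  [set T' | tiling T' /\
            forall e : R, 0 < e -> exists x, dGamma (translate x T) T' < e].

Record tiling_data (R : realType) := TilingData {
  base_tiling : tiles R;
  nproto : nat;
  proto : 'I_nproto -> set (plane R);
  proto_punc : 'I_nproto -> plane R }.

Definition Omega (R : realType) (D : tiling_data R) : set (tiles R) :=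
  hull (base_tiling D).

Definition isom_orbit (R : realType) (Q : tiles R) : set (tiles R) :=
  [set isom_act g Q | g in [set: isom R]].

Definition patches (R : realType) (D : tiling_data R) (r : R) : set (tiles R) :=
  [set Q | exists T' x, Omega D T' /\ Q = patch_in_ball T' x r].

Record standing (R : realType) (D : tiling_data R) : Prop := Standing {
  base_tilingP : tiling (base_tiling D);
  proto_polygon : forall i : 'I_(nproto D), polygon (proto i);
  proto_unrelated : forall (i j : 'I_(nproto D)) (g : isom R),
    i <> j -> isom_act_set g (proto i) <> proto j;
  tiles_proto : forall T' t, Omega D T' -> T' t ->
    exists (g : isom R) (i : 'I_(nproto D)), t = isom_act_set g (proto i);
  full_group : forall (g : isom R) (i : 'I_(nproto D)),
    exists2 T', Omega D T' & T' (isom_act_set g (proto i));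
  rot_invariant : forall T' theta, Omega D T' -> Omega D (rotate theta T');
  FLC : forall r : R, 0 < r ->
    finite_set [set isom_orbit Q | Q in patches D r];
  aperiodic : forall T' x, Omega D T' -> x <> 0 -> translate x T' <> T';
  proto_punc_interior : forall i : 'I_(nproto D),
    (proto i)^° (proto_punc i);
  proto_punc0 : forall i : 'I_(nproto D), proto_punc i = 0;
  proto_pointed_asym : forall (i : 'I_(nproto D)) (g : isom R),
    isom_act_set g (proto i) = proto i -> isom_act_pt g (proto_punc i) = proto_punc i ->
    g.1 = 0 /\ rot g.2 = 1%:M;
  (* the rule x(g(p_i)) = g(x(p_i)) assigns one puncture to each tile *)
  punc_well_defined : forall (i : 'I_(nproto D)) (g h : isom R),
    isom_act_set g (proto i) = isom_act_set h (proto i) ->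
    isom_act_pt g (proto_punc i) = isom_act_pt h (proto_punc i) }.

Section Punctured.
Variables (R : realType) (D : tiling_data R).

Definition punc (t : set (plane R)) : plane R :=
  xget 0 [set y | exists (g : isom R) (i : 'I_(nproto D)),
                    t = isom_act_set g (proto i) /\ y = isom_act_pt g (proto_punc i)].

(* The angle of a tile modulo 2 pi, as its representative in [0, 2 pi[. *)
Definition tile_angle (t : set (plane R)) : R :=
  xget 0 [set theta | 0 <= theta < 2 * pi /\
            exists (i : 'I_(nproto D)) (v : plane R),
              t = translate_set v (rot_set theta (proto i))].

Definition Omega_punc : set (tiles R) :=
  [set T' | Omega D T' /\ exists2 t, T' t & punc t = 0].

Definition tile0 (T' : tiles R) : set (plane R) :=
  xget set0 [set t | T' t /\ t 0].

Definition Rpunc_set : set (tiles R * tiles R) :=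
  [set p | exists T' t,
     [/\ Omega_punc T', T' t & p = (T', translate (- punc t) T')]].

Definition Rpunc : Type := {p : tiles R * tiles R | p \in Rpunc_set}.

HB.instance Definition _ := SubChoice.on Rpunc.

Definition src (p : Rpunc) : tiles R := (val p).1.
Definition tgt (p : Rpunc) : tiles R := (val p).2.

(* The vector x(t) of an element (T', T' - x(t)); it is determined by the pair
   because T' has no periods. *)
Definition Rvec (p : Rpunc) : plane R :=
  xget 0 [set y | exists t, [/\ src p t, y = punc t & tgt p = translate (- y) (src p)]].

Definition dR (p q : Rpunc) : R :=
  dGamma (src p) (src q) + fnorm (Rvec p - Rvec q).

Definition dR_open : set_system Rpunc :=
  [set U | forall p, U p ->
     exists2 e : R, 0 < e & forall q, dR p q < e -> U q].

Lemma dR_openT : dR_open setT.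
Proof. by move=> p _; exists 1. Qed.

Lemma dR_openI : setI_closed dR_open.
Proof.
move=> U V oU oV p [/oU[e e0 He] /oV[d d0 Hd]].
exists (Num.min e d); first by rewrite lt_min e0.
by move=> q; rewrite lt_min => /andP[/He Uq /Hd Vq].
Qed.

Lemma dR_open_bigU (I : Type) (f : I -> set Rpunc) :
  (forall i, dR_open (f i)) -> dR_open (\bigcup_i f i).
Proof.
move=> of_ p [i _ /(of_ i)[e e0 He]].
by exists e => // q /He fq; exists i.
Qed.

HB.instance Definition _ :=
  isOpenTopological.Build Rpunc dR_openT dR_openI dR_open_bigU.

Definition Cc (f : Rpunc -> R[i]) : Prop :=
  continuous (f : Rpunc -> (R[i] : numFieldType)) /\
  compact (closure [set p | f p != 0]).

Definition Rclass (T' : tiles R) : set (tiles R) :=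
  [set T'' | Rpunc_set (T', T'')].

Definition Rvalue (f : Rpunc -> R[i]) (T1 T2 : tiles R) : R[i] :=
  if insub (T1, T2) is Some p then f p else 0.

Definition convolution (f g : Rpunc -> R[i]) (p : Rpunc) : R[i] :=
  \sum_(T3 \in Rclass (src p)) Rvalue f (src p) T3 * Rvalue g T3 (tgt p).

Definition involution (f : Rpunc -> R[i]) (p : Rpunc) : R[i] :=
  (Rvalue f (tgt p) (src p))^*.

Definition diag_fun : Rpunc -> R[i] := \1_[set p | src p = tgt p].

(* Powers of a unitary: negative powers are powers of its adjoint. *)
Definition upow (f : Rpunc -> R[i]) (k : int) : Rpunc -> R[i] :=
  match k with
  | Posz n => iter n (convolution f) diag_fun
  | Negz n => iter n.+1 (convolution (involution f)) diag_fun
  end.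

Definition Vset (P : tiles R) (t t' : set (plane R)) : set Rpunc :=
  [set p | exists theta : R,
     rotate theta (translate (- punc t) P) `<=` src p /\
     tgt p = translate (- (rot theta *m (punc t' - punc t))) (src p)].

Definition efun (P : tiles R) (t t' : set (plane R)) : Rpunc -> R[i] :=
  \1_(Vset P t t').

Definition expi (theta : R) : R[i] := cos theta +i* sin theta.

Definition zfun (p : Rpunc) : R[i] :=
  if src p == tgt p then expi (tile_angle (tile0 (src p))) else 0.

Definition is_patch (P : tiles R) : Prop :=
  finite_set P /\ exists2 T', Omega_punc T' & P `<=` T'.

End Punctured.
Arguments Cc {R D}.
Arguments convolution {R D}.
Arguments involution {R D}.
Arguments upow {R D}.
Arguments punc {R} D.
Arguments tile_angle {R} D.
Arguments efun {R} D.
Arguments zfun {R} D.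
Arguments expi {R}.

Definition agree (R : realType) (P1 P2 : tiles R) : Prop :=
  disjoint_interiors (P1 `|` P2).

(* Main.v *)
(** Two punctured tilings that are close for [dGamma] differ near the origin by
    a rotation only: the small isometry carries the puncture at the origin of
    the first to a puncture of the second close to the origin, and punctures are
    uniformly discrete. Hence the sets [Vset P t t'] and the diagonal are
    uniformly clopen, and [zfun] is continuous.

    Compact supports: rotate every tiling so that its tile at the origin is a
    proto-tile. By finite local complexity the rotated tilings have finitely
    many patches in each ball, so an ultrafilter picks one patch for each
    radius; these glue to a tiling of the hull, and the angles converge in a
    compact interval. This gives a limit of the ultrafilter on every set of
    bounded [Rvec]. No triangle inequality for [dGamma] is involved.

    The identities hold because an isometry carrying [P] into a tiling is
    determined by the image of one puncture of [P]: distinct tiles have distinct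
    punctures, and pointed proto-tiles have no symmetry. So every convolution of
    two [efun]s has at most one nonzero term, and functions supported on the
    diagonal act by scalars depending on the source or on the target. *)

From HB Require Import structures.
From mathcomp Require Import all_boot all_order all_algebra.
From mathcomp Require Import all_classical all_reals all_analysis.
From mathcomp Require Import finmap complex.
From mathcomp Require Import ring lra.
Require Import Defs.
Set Implicit Arguments.
Unset Strict Implicit.
Unset Printing Implicit Defensive.
Import Order.TTheory GRing.Theory Num.Theory.
Import numFieldNormedType.Exports.
Local Open Scope classical_set_scope.
Local Open Scope ring_scope.

(** * The Frobenius norm and rotations *)

Section SquareSums.
Variables (R : rcfType) (I : finType).
Implicit Types f g : I -> R.

Lemma sum_sqr_ge0 f : 0 <= \sum_i f i ^+ 2.
Proof. by apply: sumr_ge0 => i _; exact: sqr_ge0. Qed.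

Lemma cauchy_schwarz_sum f g :
  (\sum_i f i * g i) ^+ 2 <= (\sum_i f i ^+ 2) * (\sum_i g i ^+ 2).
Proof.
have sqrB (b c : R) : \sum_i (c * f i - b * g i) ^+ 2 =
    c ^+ 2 * (\sum_i f i ^+ 2) - 2 * c * b * (\sum_i f i * g i) +
    b ^+ 2 * (\sum_i g i ^+ 2).
  by rewrite !mulr_sumr -sumrB -big_split; apply: eq_bigr => i _ /=; ring.
have := sqrB (\sum_i f i * g i) (\sum_i g i ^+ 2).
set A := \sum_i f i ^+ 2; set B := \sum_i f i * g i; set C := \sum_i g i ^+ 2.
have -> : C ^+ 2 * A - 2 * C * B * B + B ^+ 2 * C = C * (A * C - B ^+ 2).
  by ring.
move=> ABC.
have [C0|C0] := eqVneq C 0; last first.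
  have Cgt0 : 0 < C by rewrite lt_neqAle eq_sym C0 sum_sqr_ge0.
  by rewrite -subr_ge0 -(pmulr_rge0 _ Cgt0) -ABC sum_sqr_ge0.
suff -> : B = 0 by rewrite expr0n mulr_ge0 ?sum_sqr_ge0.
rewrite /B big1 // => i _; apply/eqP; rewrite mulf_eq0 -(sqrf_eq0 (g i)).
move/eqP: C0; rewrite psumr_eq0 => [/allP/(_ i)|j _]; last exact: sqr_ge0.
by rewrite mem_index_enum => /(_ isT) /= ->; rewrite orbT.
Qed.

Lemma ler_sqrt_sum_sqrD f g :
  Num.sqrt (\sum_i (f i + g i) ^+ 2) <=
  Num.sqrt (\sum_i f i ^+ 2) + Num.sqrt (\sum_i g i ^+ 2).
Proof.
rewrite -(@ler_pXn2r _ 2) ?nnegrE ?addr_ge0 ?sqrtr_ge0 //.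
rewrite [leRHS]sqrrD !sqr_sqrtr ?sum_sqr_ge0 //.
under eq_bigr do rewrite sqrrD.
rewrite !big_split /= lerD2r lerD2l -mulr2n lerMn2r /=.
rewrite (le_trans (ler_norm _)) // -sqrtrM ?sum_sqr_ge0 // -sqrtr_sqr.
by rewrite ler_wsqrtr // cauchy_schwarz_sum.
Qed.

Lemma ler_sqrt_sum_sqr f : Num.sqrt (\sum_i f i ^+ 2) <= \sum_i `|f i|.
Proof.
have sum_ge0 : 0 <= \sum_i `|f i| by exact: sumr_ge0.
rewrite -(ger0_norm sum_ge0) -sqrtr_sqr ler_wsqrtr // expr2 mulr_suml.
apply: ler_sum => i _; rewrite -real_normK ?num_real // expr2 ler_wpM2l //.
by rewrite (bigD1 i) //= lerDl sumr_ge0.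
Qed.

End SquareSums.

Section FrobeniusNorm.
Variable R : realType.

Lemma fnorm_pair m n (A : 'M[R]_(m, n)) :
  fnorm A = Num.sqrt (\sum_ij A ij.1 ij.2 ^+ 2).
Proof. by rewrite /fnorm pair_bigA. Qed.

Lemma fnorm_trace m n (A : 'M[R]_(m, n)) : fnorm A = Num.sqrt (\tr (A^T *m A)).
Proof.
rewrite /fnorm exchange_big; congr Num.sqrt; apply: eq_bigr => j _.
by rewrite !mxE; apply: eq_bigr => i _; rewrite mxE.
Qed.

Lemma fnorm_ge0 m n (A : 'M[R]_(m, n)) : 0 <= fnorm A.
Proof. exact: sqrtr_ge0. Qed.

Lemma fnorm0 m n : fnorm (0 : 'M[R]_(m, n)) = 0.
Proof. by rewrite fnorm_trace mulmx0 mxtrace0 sqrtr0. Qed.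

Lemma fnormZ m n (a : R) (A : 'M[R]_(m, n)) : fnorm (a *: A) = `|a| * fnorm A.
Proof.
rewrite /fnorm -sqrtr_sqr -sqrtrM ?sqr_ge0 // mulr_sumr; congr Num.sqrt.
apply: eq_bigr => i _; rewrite mulr_sumr; apply: eq_bigr => j _.
by rewrite mxE exprMn.
Qed.

Lemma fnormN m n (A : 'M[R]_(m, n)) : fnorm (- A) = fnorm A.
Proof. by rewrite -scaleN1r fnormZ normrN1 mul1r. Qed.

Lemma fnorm_distrC m n (A B : 'M[R]_(m, n)) : fnorm (A - B) = fnorm (B - A).
Proof. by rewrite -fnormN opprB. Qed.

Lemma ler_fnormD m n (A B : 'M[R]_(m, n)) : fnorm (A + B) <= fnorm A + fnorm B.
Proof.
rewrite !fnorm_pair; apply: le_trans (ler_sqrt_sum_sqrD _ _).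
by under eq_bigr do rewrite mxE.
Qed.

Lemma ler_fnormM m n k (A : 'M[R]_(m, n)) (B : 'M[R]_(n, k)) :
  fnorm (A *m B) <= fnorm A * fnorm B.
Proof.
rewrite /fnorm -sqrtrM; last by do 2!apply: sumr_ge0 => ? _; exact: sqr_ge0.
rewrite ler_wsqrtr // mulr_suml; apply: ler_sum => i _.
rewrite exchange_big mulr_sumr; apply: ler_sum => j _.
by rewrite mxE; exact: cauchy_schwarz_sum.
Qed.

Lemma normr_le_fnorm m n (A : 'M[R]_(m, n)) i j : `|A i j| <= fnorm A.
Proof.
rewrite fnorm_pair -sqrtr_sqr ler_wsqrtr // (bigD1 (i, j)) //= lerDl.
by apply: sumr_ge0 => ? _; exact: sqr_ge0.
Qed.

Lemma ler_fnorm_sum m n (A : 'M[R]_(m, n)) : fnorm A <= \sum_i \sum_j `|A i j|.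
Proof. by rewrite fnorm_pair pair_bigA ler_sqrt_sum_sqr. Qed.

Lemma fnorm_orthomx m n (Q : 'M[R]_m) (A : 'M[R]_(m, n)) :
  Q^T *m Q = 1%:M -> fnorm (Q *m A) = fnorm A.
Proof.
by move=> QQ; rewrite !fnorm_trace trmx_mul -mulmxA (mulmxA Q^T) QQ mul1mx.
Qed.

End FrobeniusNorm.

Section Rotations.
Variable R : realType.
Implicit Types a b : R.

Lemma rot0 : rot 0 = 1%:M :> 'M[R]_2.
Proof.
apply/matrixP => i j; rewrite !mxE cos0 sin0 oppr0.
by case: (i == j); case: (i == _).
Qed.

Lemma rotD a b : rot (a + b) = rot a *m rot b.
Proof.
apply/matrixP => i j; rewrite !mxE big_ord_recr big_ord1 /= !mxE cosD sinD /=.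
case: i => -[|[|//]] Hi; case: j => -[|[|//]] Hj; rewrite /eq_op /=; ring.
Qed.

Lemma rotN a : rot (- a) = (rot a)^T.
Proof.
apply/matrixP => i j; rewrite !mxE cosN sinN.
case: i => -[|[|//]] Hi; case: j => -[|[|//]] Hj; rewrite /eq_op //= opprK //.
Qed.

Lemma mul_rotNrot a : rot (- a) *m rot a = 1%:M.
Proof. by rewrite -rotD addNr rot0. Qed.

Lemma mul_rotrotN a : rot a *m rot (- a) = 1%:M.
Proof. by rewrite -rotD addrN rot0. Qed.

Lemma rotK a n : cancel (@mulmx R 2 2 n (rot a)) (mulmx (rot (- a))).
Proof. by move=> A; rewrite mulmxA mul_rotNrot mul1mx. Qed.

Lemma rotNK a n : cancel (@mulmx R 2 2 n (rot (- a))) (mulmx (rot a)).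
Proof. by move=> A; rewrite mulmxA mul_rotrotN mul1mx. Qed.

Lemma fnorm_rot a n (A : 'M[R]_(2, n)) : fnorm (rot a *m A) = fnorm A.
Proof. by rewrite fnorm_orthomx // -rotN mul_rotNrot. Qed.

Lemma rot_eqP a b : rot a = rot b <-> cos a = cos b /\ sin a = sin b.
Proof.
split=> [ab|[cab sab]]; last by apply/matrixP => i j; rewrite !mxE cab sab.
have /matrixP/(_ ord0 ord0) := ab; have /matrixP/(_ ord_max ord0) := ab.
by rewrite !mxE /=.
Qed.

Lemma fnorm_rotB a b : fnorm (rot (a - b) - 1%:M) = fnorm (rot a - rot b).
Proof.
rewrite -(fnorm_rot b (rot (a - b) - _)) mulmxBr mulmx1 -rotD.
by rewrite [b + _]addrC subrK.
Qed.

Lemma rot_continuous a (e : R) : 0 < e ->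
  \forall b \near a, fnorm (rot a - rot b) < e.
Proof.
move=> e0; have e4 : 0 < e / 4 by rewrite divr_gt0.
have /cvgrPdist_lt/(_ _ e4) cos_near := @continuous_cos R a.
have /cvgrPdist_lt/(_ _ e4) sin_near := @continuous_sin R a.
near=> b; apply: le_lt_trans (ler_fnorm_sum _) _.
rewrite !big_ord_recl !big_ord0 !mxE /= -opprD normrN.
have : `|cos a - cos b| < e / 4 by near: b.
have : `|sin a - sin b| < e / 4 by near: b.
lra.
Unshelve. all: by end_near. Qed.

Lemma rot_periodic : periodic (@rot R) (pi *+ 2).
Proof. by move=> a; apply/rot_eqP; rewrite cosD2pi sinD2pi. Qed.

Lemma rotD2piz a (k : int) : rot (a + pi *+ 2 *~ k) = rot a.
Proof.
case: k => n; first exact: (periodicn rot_periodic).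
rewrite NegzE mulrNz -[in RHS](subrK (pi *+ 2 *+ n.+1) a).
by rewrite (periodicn rot_periodic).
Qed.

Lemma rot_angle_repr a : exists2 b, 0 <= b < 2 * pi & rot b = rot a.
Proof.
rewrite mulr_natl; have : 0 < pi *+ 2 :> R by rewrite mulrn_wgt0 ?pi_gt0.
have := rotD2piz a (- Num.floor (a / (pi *+ 2))); move: (pi *+ 2) => T rotT T0.
exists (a + T *~ - Num.floor (a / T)) => //.
have := floor_itv (a / T).
rewrite ler_pdivlMr // ltr_pdivrMr // intrD mulrDl mul1r => /andP[floor_le].
by rewrite mulrNz -(mulrzl T) subr_ge0 floor_le ltrBlDl.
Qed.

End Rotations.

(** * Isometries of the plane *)

Lemma image_cancel (X Y : Type) (f : X -> Y) (g : Y -> X) :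
  cancel f g -> cancel (fun A => f @` A) (fun B => g @` B).
Proof.
by move=> fK A; rewrite image_comp -[RHS]image_id; apply: eq_imagel => x _ /=.
Qed.

Section Isometries.
Variable R : realType.
Implicit Types (g h : isom R) (a r s : R) (v x y : plane R).
Implicit Types (A B : set (plane R)) (T : tiles R).

Definition isom_mul g h : isom R := (h.1 + rot (- h.2) *m g.1, g.2 + h.2).

Definition isom_inv g : isom R := (- (rot g.2 *m g.1), - g.2).

Lemma isom_act_ptM g h y :
  isom_act_pt (isom_mul g h) y = isom_act_pt g (isom_act_pt h y).
Proof. by rewrite /isom_act_pt /= rotD -mulmxA addrA mulmxDr rotNK. Qed.

Lemma isom_act_pt1 y : isom_act_pt (isom1 R) y = y.
Proof. by rewrite /isom_act_pt rot0 mul1mx addr0. Qed.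

Lemma isom_act_ptK g : cancel (isom_act_pt g) (isom_act_pt (isom_inv g)).
Proof. by move=> y; rewrite /isom_act_pt /= -mulmxBr rotK addrK. Qed.

Lemma isom_act_ptVK g : cancel (isom_act_pt (isom_inv g)) (isom_act_pt g).
Proof. by move=> y; rewrite /isom_act_pt /= mulmxDr rotNK subrK. Qed.

Lemma isom_act_pt_translate v y : isom_act_pt (v, 0) y = y + v.
Proof. by rewrite /isom_act_pt rot0 mul1mx. Qed.

Lemma isom_act_pt_rot a y : isom_act_pt (0, a) y = rot a *m y.
Proof. by rewrite /isom_act_pt addr0. Qed.

Lemma isom_act_ptB g x y :
  isom_act_pt g x - isom_act_pt g y = rot g.2 *m (x - y).
Proof. by rewrite /isom_act_pt -mulmxBr opprD addrACA subrr addr0. Qed.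

Lemma fnorm_isomB g x y :
  fnorm (isom_act_pt g x - isom_act_pt g y) = fnorm (x - y).
Proof. by rewrite isom_act_ptB fnorm_rot. Qed.

Lemma fnorm_isom0 g : fnorm (isom_act_pt g 0) = fnorm g.1.
Proof. by rewrite /isom_act_pt add0r fnorm_rot. Qed.

Lemma isom_dist1_lt g r : isom_dist g (isom1 R) < r ->
  fnorm g.1 < r /\ fnorm (rot g.2 - 1%:M) < r.
Proof.
rewrite /isom_dist subr0 rot0 => gr.
by have := fnorm_ge0 g.1; have := fnorm_ge0 (rot g.2 - 1%:M); split; lra.
Qed.

Lemma isom_fix0 g : isom_act_pt g 0 = 0 ->
  isom_act_pt g =1 isom_act_pt (0, g.2).
Proof.
by move=> g0 y; rewrite isom_act_pt_rot -[y in RHS]subr0 -isom_act_ptB g0 subr0.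
Qed.

Lemma eq_isom_rot g h : isom_act_pt g =1 isom_act_pt h -> rot g.2 = rot h.2.
Proof.
move=> gh; apply/trmx_inj/row_matrixP => i; rewrite -!tr_col !colE; congr _^T.
by rewrite -[delta_mx i ord0]subr0 -!isom_act_ptB !gh.
Qed.

Lemma isom_act_setM g h A :
  isom_act_set (isom_mul g h) A = isom_act_set g (isom_act_set h A).
Proof.
rewrite /isom_act_set image_comp.
by apply: eq_imagel => y _; exact: isom_act_ptM.
Qed.

Lemma eq_isom_act_set g h A :
  isom_act_pt g =1 isom_act_pt h -> isom_act_set g A = isom_act_set h A.
Proof. by move=> gh; apply: eq_imagel => y _; exact: gh. Qed.

Lemma isom_act_setK g : cancel (isom_act_set g) (isom_act_set (isom_inv g)).
Proof. exact: image_cancel (isom_act_ptK g). Qed.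

Lemma isom_act_setVK g : cancel (isom_act_set (isom_inv g)) (isom_act_set g).
Proof. exact: image_cancel (isom_act_ptVK g). Qed.

Lemma isom_act_setS g A B : A `<=` B -> isom_act_set g A `<=` isom_act_set g B.
Proof. exact: image_subset. Qed.

Lemma isom_actM g h T : isom_act (isom_mul g h) T = isom_act g (isom_act h T).
Proof.
by rewrite /isom_act image_comp; apply: eq_imagel => t _; exact: isom_act_setM.
Qed.

Lemma eq_isom_act g h T :
  isom_act_pt g =1 isom_act_pt h -> isom_act g T = isom_act h T.
Proof. by move=> gh; apply: eq_imagel => t _; exact: eq_isom_act_set. Qed.

Lemma isom_act_set1 A : isom_act_set (isom1 R) A = A.
Proof.
by rewrite -[RHS]image_id; apply: eq_imagel => y _; exact: isom_act_pt1.
Qed.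

Lemma isom_act1 T : isom_act (isom1 R) T = T.
Proof.
by rewrite -[RHS]image_id; apply: eq_imagel => t _; exact: isom_act_set1.
Qed.

Lemma isom_actS g (S T : tiles R) : S `<=` T -> isom_act g S `<=` isom_act g T.
Proof. exact: image_subset. Qed.

Lemma translate_set_isom v A : translate_set v A = isom_act_set (v, 0) A.
Proof. by apply: eq_imagel => y _; rewrite isom_act_pt_translate. Qed.

Lemma rot_set_isom a A : rot_set a A = isom_act_set (0, a) A.
Proof. by apply: eq_imagel => y _; rewrite isom_act_pt_rot. Qed.

Lemma translate_isom v T : translate v T = isom_act (v, 0) T.
Proof. by apply: eq_imagel => t _; exact: translate_set_isom. Qed.

Lemma rotate_isom a T : rotate a T = isom_act (0, a) T.
Proof. by apply: eq_imagel => t _; exact: rot_set_isom. Qed.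

Lemma nbhs_eball x r : 0 < r -> nbhs x (eball x r).
Proof.
move=> r0; apply/nbhs_ballP; exists (r / 2); first by rewrite /= divr_gt0.
move=> y [_ xy]; apply: le_lt_trans (ler_fnorm_sum _) _.
rewrite big_ord_recl !big_ord1 !mxE [ltRHS](splitr r).
by apply: ltrD; rewrite distrC; exact: xy.
Qed.

Lemma interior_eballP A x : A^° x <-> exists2 r, 0 < r & eball x r `<=` A.
Proof.
split=> [/nbhs_ballP[r /= r0 xA]|[r r0 rA]]; last first.
  exact: filterS rA (nbhs_eball x r0).
exists r => // y xy; apply: xA; split => // i j; rewrite /ball /= distrC.
by have := normr_le_fnorm (y - x) i j; rewrite !mxE; move/le_lt_trans; apply.
Qed.

Lemma eball_center x r : 0 < r -> eball x r x.
Proof. by rewrite /eball /= subrr fnorm0. Qed.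

Lemma subset_eball x y r s : fnorm (x - y) + r <= s -> eball x r `<=` eball y s.
Proof.
move=> xyrs z xz; have := ler_fnormD (z - x) (x - y); rewrite subrKA.
move: xz; rewrite /eball /=; lra.
Qed.

Lemma eball_interior x r A : eball x r `<=` A -> eball x r `<=` A^°.
Proof.
move=> rA y xy; apply/interior_eballP; exists (r - fnorm (y - x)).
  by rewrite subr_gt0.
by apply: subset_trans rA; apply: subset_eball; rewrite addrC subrK.
Qed.

Lemma isom_act_set_eball g x r :
  isom_act_set g (eball x r) = eball (isom_act_pt g x) r.
Proof.
apply/seteqP; split=> [_ [y xy <-]|y xy].
  by rewrite /eball /= fnorm_isomB.
exists (isom_act_pt (isom_inv g) y); last exact: isom_act_ptVK.
by rewrite /eball /= -{1}(isom_act_ptK g x) fnorm_isomB.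
Qed.

Lemma isom_act_set_interior g A : (isom_act_set g A)^° = isom_act_set g A^°.
Proof.
have sub h B : isom_act_set h B^° `<=` (isom_act_set h B)^°.
  move=> _ [y /interior_eballP[r r0 rB] <-].
  apply/interior_eballP; exists r => //.
  by rewrite -isom_act_set_eball; exact: isom_act_setS.
apply/seteqP; split; last exact: sub.
rewrite -{1}(isom_act_setVK g (_^°)); apply: isom_act_setS.
by apply: subset_trans (sub _ _) _; rewrite isom_act_setK.
Qed.

Lemma patch_in_ball_isom g T x r :
  patch_in_ball (isom_act g T) (isom_act_pt g x) r =
  isom_act g (patch_in_ball T x r).
Proof.
rewrite /patch_in_ball -isom_act_set_eball.
apply/seteqP; split=> [_ [[t Tt <-] tr]|_ [t [Tt tr] <-]].
  exists t => //; split => //.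
  by have := isom_act_setS (g := isom_inv g) tr; rewrite !isom_act_setK.
by split; [exists t|exact: isom_act_setS].
Qed.

Lemma patch_in_ball_restrict (S T : tiles R) x y r s : fnorm (y - x) + s <= r ->
  patch_in_ball S x r = patch_in_ball T x r ->
  patch_in_ball S y s = patch_in_ball T y s.
Proof.
move=> /subset_eball yx ST.
have restrict (U : tiles R) :
    patch_in_ball U y s = [set t | patch_in_ball U x r t /\ t `<=` eball y s].
  apply/seteqP; split=> t [tU ty]; last by split; first exact: tU.1.
  by split => //; split => //; exact: subset_trans yx.
by rewrite !restrict ST.
Qed.

Lemma patch_in_ball_isom_eq g (S T : tiles R) r s : fnorm g.1 + s <= r ->
  patch_in_ball S 0 r = patch_in_ball T 0 r ->
  patch_in_ball (isom_act g S) 0 s = patch_in_ball (isom_act g T) 0 s.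
Proof.
move=> gsr ST; rewrite -(isom_act_ptVK g 0) !patch_in_ball_isom; congr isom_act.
apply: patch_in_ball_restrict ST.
by rewrite subr0 /isom_act_pt /= sub0r mulmxN rotK fnormN.
Qed.

End Isometries.

(** * Polygons and tilings *)

Section Polygons.
Variable R : realType.
Implicit Types (g : isom R) (r s t u : R) (a b c x : plane R).
Implicit Types (A : set (plane R)) (T : tiles R).

Lemma triangle_bounded a b c :
  triangle a b c `<=` eball 0 (fnorm a + fnorm b + fnorm c + 1).
Proof.
move=> _ [s [t [u [s0 t0 u0 stu ->]]]]; rewrite /eball /= subr0.
have shrink k x : 0 <= k -> k <= 1 -> fnorm (k *: x) <= fnorm x.
  by move=> k0 k1; rewrite fnormZ ger0_norm // ler_piMl ?fnorm_ge0.
have abc := ler_fnormD (s *: a + t *: b) (u *: c).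
have ab := ler_fnormD (s *: a) (t *: b).
have := shrink s a s0; have := shrink t b t0; have := shrink u c u0; lra.
Qed.

Lemma polygon_bounded A : polygon A -> exists r, A `<=` eball 0 r.
Proof.
move=> [l [_ _ ->]].
suff [r lr] : exists r, forall a b c,
    (a, b, c) \in l -> triangle a b c `<=` eball 0 r.
  by exists r => y [a [b [c [abc]]]]; exact: lr.
elim: l => [|[[a b] c] l [r lr]]; first by exists 0.
exists (Num.max r (fnorm a + fnorm b + fnorm c + 1)) => a' b' c'.
rewrite inE => /predU1P[[-> -> ->]|/lr abc] y.
  by move/triangle_bounded; rewrite /eball /= lt_max orbC => ->.
by move/abc; rewrite /eball /= lt_max => ->.
Qed.

(* The edge vectors [b - a] and [c - a] form a basis, so a displacement of a
   point changes its barycentric coordinates by a proportional amount. *)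
Lemma triangle_interior a b c s t u :
  \det (row_mx (b - a) (c - a) : 'M[R]_2) != 0 ->
  0 < s -> 0 < t -> 0 < u -> s + t + u = 1 ->
  (triangle a b c)^° (s *: a + t *: b + u *: c).
Proof.
set E := (X in \det X) => detE s0 t0 u0 stu; set y := _ + u *: c.
have unitE : E \in unitmx by rewrite unitmxE unitfE.
pose m := Num.min s (Num.min t u).
have [ms mt mu] : [/\ m <= s, m <= t & m <= u] by rewrite !ge_min !lexx !orbT.
have C0 : 0 < fnorm (invmx E) + 1 by rewrite ltr_wpDl ?fnorm_ge0.
apply/interior_eballP; exists (m / 2 / (fnorm (invmx E) + 1)).
  by rewrite !divr_gt0 // !lt_min s0 t0.
move=> z; rewrite /eball /= ltr_pdivlMr // => zy.
pose w : 'M[R]_(1 + 1, 1) := invmx E *m (z - y).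
pose k := usubmx w 0 0; pose l := dsubmx w 0 0.
have zyE : z - y = k *: (b - a) + l *: (c - a).
  rewrite -!mul_mx_scalar -!mx11_scalar -mul_row_col vsubmxK.
  exact: esym (mulKVmx unitE _).
have w_lt : fnorm w < m / 2.
  apply: le_lt_trans (ler_fnormM _ _) _; apply: le_lt_trans zy.
  by rewrite mulrC ler_wpM2l ?fnorm_ge0 // lerDl.
have [k_le l_le] : `|k| <= fnorm w /\ `|l| <= fnorm w.
  rewrite /k /l [usubmx w _ _]mxE [dsubmx w _ _]mxE.
  by split; exact: normr_le_fnorm.
move: k_le l_le; rewrite !ler_norml => /andP[kl ku] /andP[ll lu].
exists (s - k - l), (t + k), (u + l); split; [lra..|].
rewrite -(subrK y z) zyE /y; apply/matrixP => i j; rewrite !mxE; ring.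
Qed.

Lemma triangle_subset_closure_interior a b c :
  \det (row_mx (b - a) (c - a) : 'M[R]_2) != 0 ->
  triangle a b c `<=` closure (triangle a b c)^°.
Proof.
move=> detE x [s [t [u [s0 t0 u0 stu xE]]]] B /interior_eballP[r r0 rB].
pose m : plane R := 3^-1 *: a + 3^-1 *: b + 3^-1 *: c.
have N0 := fnorm_ge0 (m - x); pose k := r / (fnorm (m - x) + r).
have Nr : 0 < fnorm (m - x) + r by rewrite ltr_wpDl.
have k0 : 0 < k by rewrite divr_gt0.
have k1 : 0 <= 1 - k by rewrite subr_ge0 ler_pdivrMr // mul1r lerDr.
exists (x + k *: (m - x)); split; last first.
  apply: rB; rewrite /eball /= addrAC subrr add0r fnormZ gtr0_norm //.
  by rewrite mulrAC ltr_pdivrMr // ltr_pM2l // ltrDl.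
have -> : x + k *: (m - x) = ((1 - k) * s + k / 3) *: a
    + ((1 - k) * t + k / 3) *: b + ((1 - k) * u + k / 3) *: c.
  by rewrite xE; apply/matrixP => i j; rewrite !mxE; ring.
apply: triangle_interior => //; rewrite ?ltr_wpDl ?divr_gt0 ?mulr_ge0 //.
have -> : u = 1 - s - t by lra.
by field.
Qed.

Lemma polygon_subset_closure_interior A : polygon A -> A `<=` closure A^°.
Proof.
move=> [l [_ ndg ->]] x [a [b [c [abc xabc]]]].
have : closure (triangle a b c)^° x.
  by apply: triangle_subset_closure_interior => //; exact: ndg.
by apply: closureS; apply: interiorS => y yabc; exists a, b, c.
Qed.

Lemma triangle_isom g a b c : isom_act_set g (triangle a b c) =
  triangle (isom_act_pt g a) (isom_act_pt g b) (isom_act_pt g c).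
Proof.
have sub h x y z : isom_act_set h (triangle x y z) `<=`
    triangle (isom_act_pt h x) (isom_act_pt h y) (isom_act_pt h z).
  move=> _ [_ [s [t [u [s0 t0 u0 stu ->]]]] <-]; exists s, t, u; split => //.
  rewrite /isom_act_pt !scalemxAr -!mulmxDr; congr (_ *m _).
  have -> : u = 1 - s - t by lra.
  by apply/matrixP => i j; rewrite !mxE; ring.
apply/seteqP; split; first exact: sub.
rewrite -[X in X `<=` _](isom_act_setVK g); apply: isom_act_setS.
by apply: subset_trans (sub _ _ _ _) _; rewrite !isom_act_ptK.
Qed.

Lemma polygon_isom g A : polygon A -> polygon (isom_act_set g A).
Proof.
move=> [l [l0 ndg ->]].
pose g' := isom_act_pt g; pose f abc := (g' abc.1.1, g' abc.1.2, g' abc.2).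
exists (map f l); split; first by case: l l0 {ndg}.
  move=> _ _ _ /mapP[[[a b] c] /ndg abc [-> -> ->]] /=.
  rewrite !isom_act_ptB -mul_mx_row det_mulmx mulf_neq0 //.
  by rewrite -unitfE -unitmxE; have /mulmx1_unit[] := mul_rotrotN g.2.
apply/seteqP; split=> [_ [y [a [b [c [abc yabc]]]] <-]|y].
  exists (isom_act_pt g a), (isom_act_pt g b), (isom_act_pt g c).
  by split; [apply/mapP; exists (a, b, c)|rewrite -triangle_isom; exists y].
move=> [_ [_ [_ [/mapP[[[a b] c] abc [-> -> ->]]]]]] /=.
by rewrite -triangle_isom => -[x xabc <-]; exists x => //; exists a, b, c.
Qed.

Lemma tiling_isom g T : tiling T -> tiling (isom_act g T).
Proof.
move=> [countT polyT covT disjT]; split.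
- exact: card_le_trans (card_image_le _ _) countT.
- by move=> _ [t Tt <-]; exact/polygon_isom/polyT.
- apply/seteqP; split=> // y _.
  have : setT (isom_act_pt (isom_inv g) y) by [].
  rewrite -covT => -[t Tt yt]; exists (isom_act_set g t); first by exists t.
  by exists (isom_act_pt (isom_inv g) y) => //; exact: isom_act_ptVK.
- move=> _ _ [s Ts <-] [t Tt <-] st; rewrite !isom_act_set_interior.
  apply/seteqP; split=> // _ [[x xs <-] [y yt /(can_inj (isom_act_ptK g)) yx]].
  have : (s^° `&` t^°) x by split => //; rewrite -yx.
  by rewrite (disjT _ _ Ts Tt) // => sEt; apply: st; rewrite sEt.
Qed.

End Polygons.

(** * The tiling metric and the hull *)

Section TilingMetric.
Variable R : realType.
Implicit Types (S T : tiles R) (v x : plane R) (a b d e r : R) (g h : isom R).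

Lemma eps_close_sym S T e : eps_close S T e -> eps_close T S e.
Proof. by move=> [e0 e1 [g [h [ge he gh]]]]; split => //; exists h, g. Qed.

Lemma dGammaC S T : dGamma S T = dGamma T S.
Proof.
rewrite /dGamma (_ : eps_close S T = eps_close T S) //.
by apply/funext => e; apply/propext; split; exact: eps_close_sym.
Qed.

Lemma eps_close_lbound0 S T : lbound [set e | eps_close S T e] 0.
Proof. by move=> e [/ltW]. Qed.

Lemma dGamma_ge0 S T : 0 <= dGamma S T.
Proof.
rewrite /dGamma; case: asboolP => // close.
by apply: lb_le_inf => //; exact: eps_close_lbound0.
Qed.

Lemma dGamma_le S T e : eps_close S T e -> dGamma S T <= e.
Proof.
move=> ST; rewrite /dGamma; case: asboolP => [_|[]]; last by exists e.
by apply: ge_inf => //; exists 0; exact: eps_close_lbound0.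
Qed.

Definition near_copies e r S T := exists g h,
  [/\ isom_dist g (isom1 R) < e, isom_dist h (isom1 R) < e &
      patch_in_ball (isom_act g S) 0 r = patch_in_ball (isom_act h T) 0 r].

Lemma dGamma_lt_near_copies e r : 0 < e ->
  exists2 d, 0 < d & forall S T, dGamma S T < d -> near_copies e r S T.
Proof.
move=> e0; pose q := Num.max r 1; have q0 : 0 < q by rewrite lt_max ltr01 orbT.
exists (Num.min e q^-1); first by rewrite lt_min e0 invr_gt0.
move=> S T; rewrite /dGamma; case: asboolP => [close|_]; last first.
  by rewrite ltNge ge_min invf_le1 // le_max lexx !orbT.
move=> /(inf_lt close)[d [d0 _ [g [h [gd hd gh]]]]].
rewrite lt_min => /andP[de dq].
exists g, h; split; [exact: lt_trans de | exact: lt_trans de |].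
apply: patch_in_ball_restrict gh; rewrite subrr fnorm0 add0r.
rewrite (@le_trans _ _ q) ?le_max ?lexx // -[q]invrK.
by rewrite lef_pV2 ?posrE ?invr_gt0 // ltW.
Qed.

Lemma dGamma_rotate S T a b e : 0 < e -> e < 1 -> fnorm (rot a - rot b) < e ->
  patch_in_ball S 0 e^-1 = patch_in_ball T 0 e^-1 ->
  dGamma (isom_act (0, a) S) (isom_act (0, b) T) <= e.
Proof.
move=> e0 e1 ab ST; apply: dGamma_le; split => //; exists (0, b - a), (isom1 R).
rewrite /isom_dist /isom1 /= !subrr !fnorm0 !addr0 add0r rot0 fnorm_rotB.
rewrite fnorm_distrC; split => //.
rewrite isom_act1 -isom_actM (eq_isom_act (h := (0, b))).
  by apply: patch_in_ball_isom_eq ST; rewrite fnorm0 add0r.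
by move=> y; rewrite isom_act_ptM !isom_act_pt_rot mulmxA -rotD subrK.
Qed.

Variable T0 : tiles R.

Lemma hullP T : hull T0 T <-> tiling T /\
  forall e r, 0 < e -> exists x, near_copies e r (isom_act (x, 0) T0) T.
Proof.
split=> -[tT close]; split => //.
  move=> e r e0; have [d d0 copies] := dGamma_lt_near_copies r e0.
  have [x xd] := close d d0; exists x.
  by apply: copies; rewrite -translate_isom.
move=> e e0; pose c := Num.min (e / 2) 2^-1.
have c0 : 0 < c by rewrite lt_min divr_gt0 //= invr_gt0.
have [x copies] := close c c^-1 c0; exists x.
have ce : c < e by rewrite gt_min; apply/orP; left; lra.
apply: le_lt_trans ce; rewrite translate_isom; apply: dGamma_le; split => //.
by rewrite gt_min; apply/orP; right; lra.
Qed.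

Lemma hull_translate T v : hull T0 T -> hull T0 (isom_act (v, 0) T).
Proof.
move=> /hullP[tT copies].
apply/hullP; split=> [|e r e0]; first exact: tiling_isom.
have [x [g [h [ge he gh]]]] := copies e (fnorm v + r) e0.
exists (x + rot (- g.2) *m (rot h.2 *m v)), g, h; split => //.
have := @patch_in_ball_isom_eq _ (rot h.2 *m v, 0) _ _ _ r _ gh.
rewrite /= fnorm_rot lexx => /(_ isT); rewrite -!isom_actM => gh'.
rewrite (eq_isom_act (h := isom_mul (isom_mul (rot h.2 *m v, 0) g) (x, 0))).
  rewrite gh'; congr patch_in_ball; apply: eq_isom_act => y.
  by rewrite !isom_act_ptM !isom_act_pt_translate /isom_act_pt -mulmxDr addrAC.
move=> y; rewrite !isom_act_ptM !isom_act_pt_translate /isom_act_pt.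
by rewrite addrA [y + x + _ + _]addrAC [rot g.2 *m (_ + _ + _)]mulmxDr rotNK.
Qed.

Lemma hull_limit T : tiling T ->
  (forall r,
     exists2 S, hull T0 S & patch_in_ball S 0 r = patch_in_ball T 0 r) ->
  hull T0 T.
Proof.
move=> tT approx; apply/hullP; split => // e r e0.
have [S /hullP[_ copies] ST] := approx (e + r).
have [x [g [h [ge he gh]]]] := copies e r e0; exists x, g, h; split => //.
rewrite gh; apply: patch_in_ball_isom_eq ST.
by have [h_transl _] := isom_dist1_lt he; rewrite lerD2r ltW.
Qed.

End TilingMetric.

(** * Tiles and punctures *)

Lemma subset1_finite (X : Type) (A : set X) : is_subset1 A -> finite_set A.
Proof.
move=> A1; have [->|/set0P[x Ax]] := eqVneq A set0; first exact: finite_set0.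
have Ax1 : A `<=` [set x] by move=> y /(A1 x y Ax).
exact: sub_finite_set Ax1 (finite_set1 x).
Qed.

Lemma compact_separated_finite (R : realType) (V : normedModType R) (X : Type)
    (K : set V) (f : X -> V) (A : set X) (e : R) : 0 < e -> compact K ->
  (forall i, A i -> K (f i)) ->
  (forall i j, A i -> A j -> ball (f i) e (f j) -> i = j) -> finite_set A.
Proof.
move=> e0 cK AK sep; have e2 : 0 < e / 2 by rewrite divr_gt0.
move: cK; rewrite compact_cover => cK.
have [||C _ KC] := cK V K (fun x => (ball x (e / 2))^°).
- by move=> x _; exact: open_interior.
- by move=> x Kx; exists x => //; exact: nbhsx_ballx.
have AC : A `<=` \bigcup_(x in [set` C]) [set i | A i /\ ball x (e / 2) (f i)].
  by move=> i Ai; have [x Cx /interior_subset xi] := KC _ (AK i Ai); exists x.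
apply: (sub_finite_set AC).
apply: bigcup_finite => [|x _]; first exact: finite_fset.
apply: subset1_finite => i j [Ai xi] [Aj xj].
by apply: sep => //; exact: ball_splitr xi xj.
Qed.

Section Tiles.
Variables (R : realType) (D : tiling_data R) (HD : standing D).
Implicit Types (T : tiles R) (x y : plane R) (r : R) (g h : isom R).
Implicit Types (s t : set (plane R)) (i j : 'I_(nproto D)).

Definition is_tile t := exists g i, t = isom_act_set g (proto i).

Lemma is_tile_proto i : is_tile (proto i).
Proof. by exists (isom1 R), i; rewrite isom_act_set1. Qed.

Lemma Omega_tile T t : Omega D T -> T t -> is_tile t.
Proof. exact: tiles_proto. Qed.

Lemma Omega_isom T g : Omega D T -> Omega D (isom_act g T).
Proof.
move=> OT; have := rot_invariant HD g.2 (hull_translate g.1 OT).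
rewrite rotate_isom -isom_actM (eq_isom_act (h := g)) // => y.
by rewrite isom_act_ptM isom_act_pt_translate isom_act_pt_rot.
Qed.

Lemma proto_isom_fix i g :
  isom_act_set g (proto i) = proto i -> isom_act_pt g =1 id.
Proof.
move=> gi; have gpunc : isom_act_pt g (proto_punc i) = proto_punc i.
  rewrite -[RHS]isom_act_pt1; apply: (punc_well_defined HD).
  by rewrite isom_act_set1.
have [g_transl g_rot] := proto_pointed_asym HD gi gpunc.
by move=> y; rewrite /isom_act_pt g_transl g_rot mul1mx addr0.
Qed.

Lemma proto_isom_inj i j g h :
  isom_act_set g (proto i) = isom_act_set h (proto j) ->
  i = j /\ isom_act_pt g =1 isom_act_pt h.
Proof.
move=> gh; pose k := isom_mul (isom_inv h) g.
have kij : isom_act_set k (proto i) = proto j.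
  by rewrite isom_act_setM gh isom_act_setK.
have ij : i = j by apply: contrapT => /(proto_unrelated HD (g := k)).
subst j; split=> // y; rewrite -[LHS](isom_act_ptVK h).
by rewrite -(isom_act_ptM (isom_inv h)) -/k (proto_isom_fix kij).
Qed.

Lemma tile_isom_inj t g h : is_tile t ->
  isom_act_set g t = isom_act_set h t -> isom_act_pt g =1 isom_act_pt h.
Proof.
move=> [k [i ->]]; rewrite -!isom_act_setM => /proto_isom_inj[_ gh] y.
by have := gh (isom_act_pt (isom_inv k) y); rewrite !isom_act_ptM isom_act_ptVK.
Qed.

Lemma punc_proto g i :
  punc D (isom_act_set g (proto i)) = isom_act_pt g (proto_punc i).
Proof.
apply: xget_unique; first by exists g, i.
by move=> _ [h [j [/proto_isom_inj[<- gh] ->]]].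
Qed.

Lemma punc_proto0 i : punc D (proto i) = 0.
Proof.
by rewrite -[proto i]isom_act_set1 punc_proto isom_act_pt1 (proto_punc0 HD).
Qed.

Lemma punc_isom g t : is_tile t ->
  punc D (isom_act_set g t) = isom_act_pt g (punc D t).
Proof.
by move=> [h [i ->]]; rewrite -isom_act_setM !punc_proto isom_act_ptM.
Qed.

Lemma tile_angle_proto g i :
  rot (tile_angle D (isom_act_set g (proto i))) = rot g.2.
Proof.
rewrite /tile_angle; case: xgetP => [a _ [_ [j [v]]]|noangle].
  rewrite translate_set_isom rot_set_isom -isom_act_setM.
  by move=> /proto_isom_inj[_ /eq_isom_rot] ->; rewrite /= add0r.
have [a a_itv ag] := rot_angle_repr g.2.
exfalso; apply: (noangle a); split => //; exists i, (isom_act_pt g 0).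
rewrite translate_set_isom rot_set_isom -isom_act_setM.
apply: eq_isom_act_set => y.
rewrite isom_act_ptM isom_act_pt_translate isom_act_pt_rot.
by rewrite /isom_act_pt add0r mulmxDr ag.
Qed.

Lemma tile_angle_isom g t : is_tile t ->
  rot (tile_angle D (isom_act_set g t)) = rot (g.2 + tile_angle D t).
Proof.
by move=> [h [i ->]]; rewrite -isom_act_setM rotD !tile_angle_proto -rotD.
Qed.

Lemma unrotate_tile t : is_tile t -> punc D t = 0 ->
  exists i, isom_act_set (0, - tile_angle D t) t = proto i.
Proof.
move=> [g [i ->]]; rewrite punc_proto (proto_punc0 HD) => /isom_fix0 g0.
exists i; rewrite -isom_act_setM -[RHS]isom_act_set1.
apply: eq_isom_act_set => y.
rewrite isom_act_pt1 isom_act_ptM g0 !isom_act_pt_rot.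
by rewrite rotN tile_angle_proto -rotN rotK.
Qed.

Lemma inner_radius :
  exists2 r, 0 < r & forall t, is_tile t -> eball (punc D t) r `<=` t.
Proof.
have near_inner i : \forall r \near 0^'+, eball (proto_punc i) r `<=` proto i.
  have /interior_eballP[e e0 ei] := proto_punc_interior HD i.
  near=> r; apply: subset_trans ei; apply: subset_eball.
  by rewrite subrr fnorm0 add0r ltW //; near: r; exact: nbhs_right_lt.
have [r [r0 ri]] :=
  filter_ex (filterI (nbhs_right_gt 0) (filter_forall _ near_inner)).
exists r => // _ [g [i ->]].
by rewrite punc_proto -isom_act_set_eball; exact: isom_act_setS.
Unshelve. all: by end_near. Qed.

Lemma outer_radius :
  exists2 r, 0 < r & forall t, is_tile t -> t `<=` eball (punc D t) r.
Proof.
have near_outer i : \forall r \near +oo, proto i `<=` eball (proto_punc i) r.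
  have [e ei] := polygon_bounded (proto_polygon HD i).
  near=> r; apply: (subset_trans ei); apply: subset_eball.
  by near: r; apply: nbhs_pinfty_ge; exact: num_real.
have [r [r0 ri]] := filter_ex
  (filterI (nbhs_pinfty_gt (num_real 0)) (filter_forall _ near_outer)).
exists r => // _ [g [i ->]].
by rewrite punc_proto -isom_act_set_eball; exact: isom_act_setS.
Unshelve. all: by end_near. Qed.

Lemma Omega_interior_eq T s t y :
  Omega D T -> T s -> T t -> s^° y -> t^° y -> s = t.
Proof.
move=> [[_ _ _ disjT] _] Ts Tt sy ty; apply: contrapT => st.
have : (s^° `&` t^°) y by [].
by rewrite (disjT _ _ Ts Tt st).
Qed.

Lemma punc_separated : exists2 r, 0 < r & forall T s t,
  Omega D T -> T s -> T t -> fnorm (punc D s - punc D t) < r -> s = t.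
Proof.
have [r r0 inner] := inner_radius; exists r => // T s t OT Ts Tt st.
apply: (Omega_interior_eq (y := punc D s) OT Ts Tt).
  exact: eball_interior (inner s (Omega_tile OT Ts)) _ (eball_center _ r0).
exact: eball_interior (inner t (Omega_tile OT Tt)) _ st.
Qed.

Lemma tile0_eq T t : Omega D T -> T t -> punc D t = 0 -> tile0 T = t.
Proof.
have [r r0 inner] := inner_radius => OT Tt t0.
have := inner t (Omega_tile OT Tt); rewrite t0 => rt.
apply: xget_unique; first by split => //; apply: rt; exact: eball_center.
move=> s [Ts s0]; have [[_ polyT _ _] _] := OT.
have [y [sy ry]] :=
  polygon_subset_closure_interior (polyT s Ts) s0 (nbhs_eball 0 r0).
exact: Omega_interior_eq OT Ts Tt sy (eball_interior rt ry).
Qed.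

Lemma patch_in_ball_finite T x r :
  Omega D T -> finite_set (patch_in_ball T x r).
Proof.
move=> OT; have [e e0 sep] := punc_separated; have [q q0 inner] := inner_radius.
pose itv k := [set` `[x k ord0 - r, x k ord0 + r]].
have e2 : 0 < e / 2 by rewrite divr_gt0.
apply: (@compact_separated_finite R 'rV[R]_2 _
  [set v | forall k, itv k (v ord0 k)] (fun t => (punc D t)^T) _ (e / 2)) => //.
- by apply: rV_compact => k; exact: segment_compact.
- move=> t [Tt tr] k; have tx : fnorm (punc D t - x) < r.
    by apply/tr/(inner t (Omega_tile OT Tt)); exact: eball_center.
  rewrite /itv /= in_itv /= -ler_distl mxE.
  by have := normr_le_fnorm (punc D t - x) k ord0; rewrite !mxE; lra.
- move=> s t [Ts _] [Tt _] [_ st]; apply: (sep T) => //.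
  apply: le_lt_trans (ler_fnorm_sum _) _; rewrite big_ord_recr !big_ord1 !mxE.
  rewrite [ltRHS](splitr e) ltrD //.
    by have := st ord0 (widen_ord (leqnSn 1) ord0); rewrite !mxE.
  by have := st ord0 ord_max; rewrite !mxE.
Qed.

End Tiles.

(** * The punctured hull and its equivalence relation *)

Lemma finite_set_bounded (R : realDomainType) (X : choiceType) (A : set X)
    (f : X -> R) :
  finite_set A -> exists M, forall x, A x -> f x <= M.
Proof.
move=> /finite_seqP[s ->]; elim: s => [|a s [M fM]]; first by exists 0.
exists (Num.max (f a) M) => x /=; rewrite inE => /predU1P[->|/fM fx].
  by rewrite le_max lexx.
by rewrite le_max fx orbT.
Qed.

Section PuncturedHull.
Variables (R : realType) (D : tiling_data R) (HD : standing D).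
Implicit Types (S T : tiles R) (v w : plane R) (a e r : R) (g h : isom R).
Implicit Types (s t : set (plane R)) (p q : Rpunc D).

Lemma punc_inj T s t : Omega D T -> T s -> T t -> punc D s = punc D t -> s = t.
Proof.
have [r r0 sep] := punc_separated HD => OT Ts Tt st.
by apply: sep OT Ts Tt _; rewrite st subrr fnorm0.
Qed.

Lemma isom_eq_of_tile T t g h : is_tile D t -> Omega D T ->
  T (isom_act_set g t) -> T (isom_act_set h t) ->
  isom_act_pt g (punc D t) = isom_act_pt h (punc D t) ->
  isom_act_pt g =1 isom_act_pt h.
Proof.
move=> tt OT Tg Th gh; apply: (tile_isom_inj HD tt); apply: punc_inj OT Tg Th _.
by rewrite !punc_isom.
Qed.

Lemma Omega_punc_isom T t g :
  Omega D T -> T t -> isom_act_pt g (punc D t) = 0 ->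
  Omega_punc D (isom_act g T).
Proof.
move=> OT Tt gt; split; first exact: Omega_isom.
exists (isom_act_set g t); first by exists t.
by rewrite punc_isom //; exact: Omega_tile Tt.
Qed.

Lemma tile0P T : Omega_punc D T -> T (tile0 T) /\ punc D (tile0 T) = 0.
Proof. by move=> [OT [t Tt t0]]; rewrite (tile0_eq HD OT Tt t0). Qed.

Lemma tile0_is_tile T : Omega_punc D T -> is_tile D (tile0 T).
Proof. by move=> OT; apply: Omega_tile OT.1 (tile0P OT).1. Qed.

Lemma matching_copies_tile : exists M, forall S T g h r s,
  Omega D S -> fnorm g.1 <= 1 ->
  patch_in_ball (isom_act g S) 0 (r + M) =
    patch_in_ball (isom_act h T) 0 (r + M) ->
  S s -> fnorm (punc D s) <= r -> T (isom_act_set (isom_mul (isom_inv h) g) s).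
Proof.
have [M M0 outer] := outer_radius HD.
exists (1 + M) => S T g h r s OS g_transl gh Ss sr.
have : patch_in_ball (isom_act g S) 0 (r + (1 + M)) (isom_act_set g s).
  split; first by exists s.
  apply: subset_trans (isom_act_setS (outer s (Omega_tile HD OS Ss))) _.
  rewrite isom_act_set_eball; apply: subset_eball; rewrite subr0.
  have := ler_fnormD
    (isom_act_pt g (punc D s) - isom_act_pt g 0) (isom_act_pt g 0).
  by rewrite subrK fnorm_isomB subr0 fnorm_isom0; lra.
by rewrite gh => -[[t Tt tE] _]; rewrite isom_act_setM -tE isom_act_setK.
Qed.

Lemma dGamma_lt_rotation r e : 0 < e -> exists2 d, 0 < d & forall S T,
  Omega_punc D S -> Omega_punc D T -> dGamma S T < d ->
  exists2 a, fnorm (rot a - 1%:M) < e &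
    forall s, S s -> fnorm (punc D s) <= r -> T (isom_act_set (0, a) s).
Proof.
move=> e0; have [M carry] := matching_copies_tile.
have [q q0 sep] := punc_separated HD.
pose c := Num.min (Num.min (q / 2) (e / 2)) 1.
have c0 : 0 < c by rewrite !lt_min !divr_gt0 //=.
have [cq ce c1] : [/\ c <= q / 2, c <= e / 2 & c <= 1].
  by rewrite /c !ge_min !lexx !orbT.
have [d d0 close] := dGamma_lt_near_copies (`|r| + M) c0.
exists d => // S T OS OT /close[g [h [/isom_dist1_lt[g_transl g_rot]]]].
move=> /isom_dist1_lt[h_transl h_rot] gh.
pose k := isom_mul (isom_inv h) g.
have kS s : S s -> fnorm (punc D s) <= `|r| -> T (isom_act_set k s).
  by apply: carry gh; [exact: OS.1|rewrite (le_trans (ltW g_transl))].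
have [S0 s0] := tile0P OS; have [T0 t0] := tile0P OT.
have punc_k : punc D (isom_act_set k (tile0 S)) = isom_act_pt k 0.
  by rewrite punc_isom ?s0 //; exact: tile0_is_tile.
have k0 : isom_act_pt k 0 = 0.
  have kS0 : T (isom_act_set k (tile0 S)) by apply: kS; rewrite // s0 fnorm0.
  rewrite -punc_k (sep T _ _ OT.1 kS0 T0) // punc_k t0 subr0 isom_act_ptM.
  rewrite -[X in fnorm X]subr0 -[X in _ - X](isom_act_ptK h) fnorm_isomB.
  apply: le_lt_trans (ler_fnormD _ _) _; rewrite fnormN !fnorm_isom0; lra.
exists k.2 => [|s Ss sr].
  rewrite /k /= [- h.2 + _]addrC fnorm_rotB -(subrKA 1%:M).
  apply: le_lt_trans (ler_fnormD _ _) _; rewrite (fnorm_distrC 1%:M); lra.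
rewrite -(eq_isom_act_set _ (isom_fix0 k0)); apply: kS => //.
exact: le_trans (ler_norm r).
Qed.

Definition Rpair T1 T2 (T12 : Rpunc_set D (T1, T2)) : Rpunc D :=
  Sub (T1, T2) (mem_set T12).

Lemma Rpunc_ext p q : src p = src q -> tgt p = tgt q -> p = q.
Proof.
rewrite /src /tgt => pq1 pq2; apply/val_inj.
by rewrite [LHS]surjective_pairing pq1 pq2 -surjective_pairing.
Qed.

Lemma Rpunc_setP T1 T2 : Rpunc_set D (T1, T2) <->
  Omega_punc D T1 /\ exists2 t, T1 t & T2 = isom_act (- punc D t, 0) T1.
Proof.
split=> [[T [t [OT Tt [-> ->]]]]|[OT [t Tt ->]]].
  by split => //; exists t; rewrite // translate_isom.
by exists T1, t; rewrite translate_isom.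
Qed.

Lemma Rpunc_set_src_tgt p : Rpunc_set D (src p, tgt p).
Proof. by rewrite /src /tgt -surjective_pairing; apply/set_mem/(valP p). Qed.

Lemma Omega_punc_src p : Omega_punc D (src p).
Proof. by have /Rpunc_setP[] := Rpunc_set_src_tgt p. Qed.

Lemma Omega_src p : Omega D (src p).
Proof. exact: (Omega_punc_src p).1. Qed.

Lemma Rvec_tile p : exists2 t, src p t & punc D t = Rvec p.
Proof.
rewrite /Rvec; case: xgetP => [_ _ [t [pt -> _]]|novec]; first by exists t.
have /Rpunc_setP[_ [t Tt tE]] := Rpunc_set_src_tgt p.
by exfalso; apply: (novec (punc D t)); exists t; rewrite translate_isom.
Qed.

Lemma tgt_isom p : tgt p = isom_act (- Rvec p, 0) (src p).
Proof.
rewrite /Rvec; case: xgetP => [v _ [t [_ _ ->]]|novec].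
  exact: translate_isom.
have /Rpunc_setP[_ [t Tt tE]] := Rpunc_set_src_tgt p.
by exfalso; apply: (novec (punc D t)); exists t; rewrite translate_isom.
Qed.

Lemma src_isom p : src p = isom_act (Rvec p, 0) (tgt p).
Proof.
rewrite tgt_isom -isom_actM -[LHS]isom_act1; apply: eq_isom_act => y.
by rewrite isom_act_pt1 isom_act_ptM !isom_act_pt_translate subrK.
Qed.

Lemma Omega_punc_tgt p : Omega_punc D (tgt p).
Proof.
have [t pt tp] := Rvec_tile p; rewrite tgt_isom.
apply: Omega_punc_isom (Omega_src p) pt _.
by rewrite isom_act_pt_translate tp subrr.
Qed.

Lemma translate_inj_Omega T v w : Omega D T ->
  isom_act (v, 0) T = isom_act (w, 0) T -> v = w.
Proof.
move=> OT vw; apply/eqP; rewrite -subr_eq0; apply/negP => /negP/eqP vw0.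
apply: (aperiodic HD OT vw0); rewrite translate_isom.
have := congr1 (isom_act (- w, 0)) vw; rewrite -!isom_actM => vw'.
rewrite (eq_isom_act (h := isom_mul (- w, 0) (v, 0))).
  rewrite vw' -[RHS]isom_act1; apply: eq_isom_act => y.
  by rewrite isom_act_pt1 isom_act_ptM !isom_act_pt_translate addrK.
by move=> y; rewrite isom_act_ptM !isom_act_pt_translate addrA.
Qed.

Lemma Rvec_unique p v : tgt p = isom_act (- v, 0) (src p) -> Rvec p = v.
Proof.
by rewrite tgt_isom => /(translate_inj_Omega (Omega_src p))/oppr_inj.
Qed.

Lemma Rpunc_eq p q : src p = src q -> Rvec p = Rvec q -> p = q.
Proof.
by move=> pq Rpq; apply: Rpunc_ext => //; rewrite !tgt_isom pq Rpq.
Qed.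

Lemma Rpunc_of_tile T t : Omega_punc D T -> T t ->
  exists p, src p = T /\ Rvec p = punc D t.
Proof.
move=> OT Tt; have RT : Rpunc_set D (T, isom_act (- punc D t, 0) T).
  by apply/Rpunc_setP; split => //; exists t.
by exists (Rpair RT); split => //; exact: Rvec_unique.
Qed.

Lemma Rvec_eq0 p : Rvec p = 0 <-> src p = tgt p.
Proof.
split=> [Rp0|pp]; last by apply: Rvec_unique; rewrite oppr0 -pp isom_act1.
by rewrite tgt_isom Rp0 oppr0 isom_act1.
Qed.

Lemma Rpunc_set_refl T : Omega_punc D T -> Rpunc_set D (T, T).
Proof.
move=> OT; have [T0 t0] := tile0P OT; apply/Rpunc_setP; split => //.
by exists (tile0 T); rewrite // t0 oppr0 isom_act1.
Qed.

Lemma Rpunc_set_sym p : Rpunc_set D (tgt p, src p).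
Proof.
apply/Rpunc_setP; split; first exact: Omega_punc_tgt.
have [S0 s0] := tile0P (Omega_punc_src p).
exists (isom_act_set (- Rvec p, 0) (tile0 (src p))).
  by rewrite tgt_isom; exists (tile0 (src p)).
rewrite punc_isom //; last exact/tile0_is_tile/Omega_punc_src.
by rewrite s0 isom_act_pt_translate add0r opprK -src_isom.
Qed.

Definition Runit T (OT : Omega_punc D T) : Rpunc D := Rpair (Rpunc_set_refl OT).

Definition Rinv p : Rpunc D := Rpair (Rpunc_set_sym p).

Lemma src_inv p : src (Rinv p) = tgt p. Proof. by []. Qed.

Lemma tgt_inv p : tgt (Rinv p) = src p. Proof. by []. Qed.

Lemma Rvec_inv p : Rvec (Rinv p) = - Rvec p.
Proof. by apply: Rvec_unique; rewrite opprK -src_isom. Qed.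

(* [p] is the product of [q1] and [q2] in the groupoid [Rpunc D]. *)
Definition Rfactors q1 q2 p :=
  [/\ src q1 = src p, tgt q1 = src q2 & tgt q2 = tgt p].

Lemma Rvec_factors q1 q2 p : Rfactors q1 q2 p -> Rvec p = Rvec q1 + Rvec q2.
Proof.
move=> [s1 t1s2 t2]; apply: Rvec_unique.
rewrite -t2 tgt_isom -t1s2 tgt_isom s1 -isom_actM; apply: eq_isom_act => y.
by rewrite isom_act_ptM !isom_act_pt_translate opprD addrA.
Qed.

Lemma Rfactors_exists q1 p : src q1 = src p -> exists q2, Rfactors q1 q2 p.
Proof.
move=> s1; have [t pt tp] := Rvec_tile p.
have tt : is_tile D t := Omega_tile HD (Omega_src p) pt.
have [||q2 [s2 R2]] := @Rpunc_of_tile (tgt q1) (isom_act_set (- Rvec q1, 0) t).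
- exact: Omega_punc_tgt.
- by rewrite tgt_isom s1; exists t.
exists q2; split => //.
rewrite tgt_isom s2 R2 punc_isom // isom_act_pt_translate tp.
rewrite !tgt_isom s1 -isom_actM; apply: eq_isom_act => y.
rewrite isom_act_ptM !isom_act_pt_translate opprD opprK addrA.
by rewrite [y - _ - _]addrAC subrK.
Qed.

End PuncturedHull.

(** * The sets [Vset P t t'] *)

Section Cylinders.
Variables (R : realType) (D : tiling_data R) (HD : standing D).
Implicit Types (T P : tiles R) (g : isom R) (t : set (plane R)).
Implicit Types (p q : Rpunc D).

Lemma is_patch_tile P t : is_patch D P -> P t -> is_tile D t.
Proof. by move=> [_ [T [OT _] PT]] /PT; exact: Omega_tile. Qed.

Definition angle0 T := tile_angle D (tile0 T).

Lemma angle0_isom T t g : is_tile D t -> Omega D T -> T (isom_act_set g t) ->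
  isom_act_pt g (punc D t) = 0 -> rot (angle0 T) = rot (g.2 + tile_angle D t).
Proof.
move=> tt OT Tg g0; rewrite /angle0 (tile0_eq HD OT Tg) ?tile_angle_isom //.
by rewrite punc_isom.
Qed.

Lemma VsetP P t t' p : Vset P t t' p <-> exists g,
  [/\ isom_act g P `<=` src p, isom_act_pt g (punc D t) = 0 &
      isom_act_pt g (punc D t') = Rvec p].
Proof.
have copyE a : rotate a (translate (- punc D t) P) = isom_act (- punc D t, a) P.
  rewrite rotate_isom translate_isom -isom_actM; apply: eq_isom_act => y.
  by rewrite isom_act_ptM isom_act_pt_rot isom_act_pt_translate.
split=> [[a [Pp tgtE]]|[g [Pp g0 gR]]].
  exists (- punc D t, a).
  rewrite -copyE /isom_act_pt /= subrr mulmx0; split => //.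
  by apply/esym/(Rvec_unique HD); rewrite -translate_isom.
exists g.2.
rewrite copyE translate_isom -isom_act_ptB gR g0 subr0 tgt_isom; split => //.
rewrite (eq_isom_act (h := g)) // => y.
by rewrite -[RHS]subr0 -g0 isom_act_ptB.
Qed.

Lemma Vset_inv P t t' p : Vset P t t' p -> Vset P t' t (Rinv HD p).
Proof.
move=> /VsetP[g [Pp g0 gR]]; apply/VsetP; exists (isom_mul (- Rvec p, 0) g).
rewrite Rvec_inv !isom_act_ptM !isom_act_pt_translate gR g0 subrr add0r.
by split => //; rewrite src_inv tgt_isom isom_actM; exact: isom_actS.
Qed.

Lemma Vset_mul P1 P2 t1 t t2 p q1 q2 : is_tile D t -> P1 t -> P2 t ->
  Rfactors q1 q2 p -> Vset P1 t1 t q1 -> Vset P2 t t2 q2 ->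
  Vset (P1 `|` P2) t1 t2 p.
Proof.
move=> tt P1t P2t fp /VsetP[g [gP g0 gR]] /VsetP[h [hP h0 hR]].
have [s1 t1s2 _] := fp; pose k := isom_mul (Rvec q1, 0) h.
have kP : isom_act k P2 `<=` src q1.
  by rewrite [X in _ `<=` X]src_isom isom_actM t1s2; exact: isom_actS.
have gk : isom_act_pt g =1 isom_act_pt k.
  apply: (isom_eq_of_tile HD tt (Omega_src q1)).
  - by apply: gP; exists t.
  - by apply: kP; exists t.
  - by rewrite gR isom_act_ptM isom_act_pt_translate h0 add0r.
apply/VsetP; exists g.
rewrite g0 gk isom_act_ptM isom_act_pt_translate hR; split => //.
  rewrite /isom_act image_setU -s1 => u [|]; first exact: gP.
  by rewrite -/(isom_act g P2) (eq_isom_act _ gk); exact: kP.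
by rewrite (Rvec_factors HD fp) addrC.
Qed.

Lemma Vset_factor P1 P2 t1 t t2 p : is_tile D t -> P1 t ->
  Vset (P1 `|` P2) t1 t2 p ->
  exists q1 q2, [/\ Rfactors q1 q2 p, Vset P1 t1 t q1 & Vset P2 t t2 q2].
Proof.
move=> tt P1t /VsetP[g [gP g0 gR]].
have gt : src p (isom_act_set g t) by apply: gP; exists t => //; left.
have [q1 [s1 R1]] := Rpunc_of_tile HD (Omega_punc_src p) gt.
rewrite punc_isom // in R1; have [q2 fp] := Rfactors_exists HD s1.
have [_ t1s2 _] := fp; exists q1, q2; split => //.
  apply/VsetP; exists g; rewrite s1 R1; split => //.
  by apply: subset_trans gP; apply: isom_actS => u; left.
apply/VsetP; exists (isom_mul (- Rvec q1, 0) g).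
rewrite !isom_act_ptM !isom_act_pt_translate R1 gR subrr; split => //.
  rewrite -t1s2 tgt_isom isom_actM s1 R1; apply: isom_actS.
  by apply: subset_trans gP; apply: isom_actS => u; right.
by rewrite (Rvec_factors HD fp) R1 addrAC subrr add0r.
Qed.

Lemma Vset_inj P t t' p q : is_tile D t -> P t -> src p = src q ->
  Vset P t t' p -> Vset P t t' q -> p = q.
Proof.
move=> tt Pt pq /VsetP[g [gP g0 gR]] /VsetP[h [hP h0 hR]].
apply: (Rpunc_eq pq); rewrite -gR -hR.
apply: (isom_eq_of_tile HD tt (Omega_src p)).
- by apply: gP; exists t.
- by rewrite pq; apply: hP; exists t.
- by rewrite g0 h0.
Qed.

Lemma Vset_angle0 P t t' p : is_tile D t -> is_tile D t' -> P t -> P t' ->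
  Vset P t t' p ->
  rot (angle0 (tgt p)) =
  rot (angle0 (src p) + (tile_angle D t' - tile_angle D t)).
Proof.
move=> tt tt' Pt Pt' /VsetP[g [gP g0 gR]].
have srcE : rot (angle0 (src p)) = rot (g.2 + tile_angle D t).
  by apply: angle0_isom (Omega_src p) _ g0 => //; apply: gP; exists t.
have tgtE : rot (angle0 (tgt p)) = rot (g.2 + tile_angle D t').
  rewrite (angle0_isom (g := isom_mul (- Rvec p, 0) g) tt') /= ?add0r //.
  - exact: (Omega_punc_tgt HD p).1.
  - rewrite tgt_isom isom_act_setM; exists (isom_act_set g t') => //.
    by apply: gP; exists t'.
  - by rewrite isom_act_ptM isom_act_pt_translate gR subrr.
by rewrite tgtE [RHS]rotD srcE -rotD; congr rot; ring.
Qed.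

Lemma Vset_fnorm_Rvec P t t' p : Vset P t t' p ->
  fnorm (Rvec p) = fnorm (punc D t' - punc D t).
Proof.
by move=> /VsetP[g [_ g0 <-]]; rewrite -[X in fnorm X]subr0 -g0 fnorm_isomB.
Qed.

End Cylinders.

(** * Topology of the equivalence relation *)

Lemma ultra_finite_choice (X : Type) (U : choiceType) (F : set_system X)
    (f : X -> U) (S : set U) :
  UltraFilter F -> finite_set S -> F (f @^-1` S) ->
  exists2 s, S s & F (f @^-1` [set s]).
Proof.
move=> UF /finite_seqP[l ->]; elim: l => [|s l IH] FS.
  by have [x] := filter_ex FS.
have [Fs|Fns] := in_ultra_setVsetC (f @^-1` [set s]) UF.
  by exists s; rewrite //= mem_head.
have [|u ul Fu] := IH; last by exists u => //=; rewrite inE [u \in l]ul orbT.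
by apply: filterS (filterI FS Fns) => x [] /=; rewrite inE => /predU1P[].
Qed.

Lemma ultra_cvg_compact (X : Type) (U : topologicalType) (F : set_system X)
    (f : X -> U) (K : set U) :
  UltraFilter F -> compact K -> F (f @^-1` K) -> exists2 c, K c & f @ F --> c.
Proof.
move=> UF cK FK; have PF : ProperFilter (f @ F) by exact: fmap_proper_filter.
have [c [Kc clc]] := cK _ PF FK; exists c => // B cB.
have [//|FnB] := in_ultra_setVsetC (f @^-1` B) UF.
by have [u [nBu Bu]] := clc (~` B) B FnB cB.
Qed.

Section Compactness.
Variables (R : realType) (D : tiling_data R) (HD : standing D).
Implicit Types (S T P : tiles R) (a b d e r : R) (t : set (plane R)).
Implicit Types (p q : Rpunc D) (A : set (Rpunc D)).

Lemma dRC p q : dR p q = dR q p.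
Proof. by rewrite /dR dGammaC fnorm_distrC. Qed.

Lemma dR_lt p q e : dR p q < e ->
  dGamma (src p) (src q) < e /\ fnorm (Rvec p - Rvec q) < e.
Proof.
rewrite /dR => pqe; have := dGamma_ge0 (src p) (src q).
by have := fnorm_ge0 (Rvec p - Rvec q); split; lra.
Qed.

Lemma open_dRE A : open A = dR_open A. Proof. by []. Qed.

Lemma cvg_dR (F : set_system (Rpunc D)) p : Filter F ->
  (forall e, 0 < e -> F [set q | dR p q < e]) -> F --> p.
Proof.
move=> FF Fp A; rewrite nbhsE => -[U [oU Up] UA]; apply: filterS UA _.
move: oU; rewrite open_dRE => /(_ p Up)[e e0 pU].
by apply: filterS (Fp e e0) => q; exact: pU.
Qed.

Definition dR_stable A :=
  exists2 d, 0 < d & forall p q, dR p q < d -> A p -> A q.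

Lemma dR_stable_closed A : dR_stable A -> closed A.
Proof.
move=> [d d0 stab]; rewrite -openC open_dRE => p nAp.
by exists d => // q pq Aq; apply/nAp/(stab q p) => //; rewrite dRC.
Qed.

Lemma diag_dR_stable : dR_stable [set p | src p = tgt p].
Proof.
have [r r0 sep] := punc_separated HD; exists r => // p q /dR_lt[_ pq].
move=> /(Rvec_eq0 HD) Rp0; apply/(Rvec_eq0 HD).
have [t qt tq] := Rvec_tile q; have [S0 s0] := tile0P HD (Omega_punc_src q).
rewrite -tq (sep (src q) t (tile0 (src q))) ?s0 //; first exact: Omega_src.
by rewrite tq subr0 -[Rvec q]opprK fnormN -(add0r (- Rvec q)) -Rp0.
Qed.

Lemma Vset_dR_stable P t t' : is_patch D P -> P t -> P t' ->
  dR_stable (Vset P t t').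
Proof.
move=> patchP Pt Pt'; have [r r0 sep] := punc_separated HD.
have [L PL] :=
  finite_set_bounded (fun s => fnorm (punc D s - punc D t)) patchP.1.
set N := fnorm (punc D t' - punc D t).
have N1 : 0 < N + 1 by rewrite ltr_wpDl // fnorm_ge0.
have e0 : 0 < r / 2 / (N + 1) by rewrite !divr_gt0.
have [d d0 close] := dGamma_lt_rotation HD L e0.
exists (Num.min d (r / 2)); first by rewrite lt_min d0 divr_gt0.
move=> p q /dR_lt[]; rewrite !lt_min => /andP[pqd _] /andP[_ pqr] Vp.
have [a a1 carry] := close _ _ (Omega_punc_src p) (Omega_punc_src q) pqd.
have RpN : fnorm (Rvec p) = N by exact: Vset_fnorm_Rvec Vp.
have /(VsetP HD)[g [gP g0 gR]] := Vp; pose k := isom_mul (0, a) g.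
have kP : isom_act k P `<=` src q.
  move=> _ [s Ps <-]; have ts := is_patch_tile HD patchP Ps.
  rewrite isom_act_setM; apply: carry; first by apply: gP; exists s.
  by rewrite punc_isom // -[X in fnorm X]subr0 -g0 fnorm_isomB PL.
have kR : isom_act_pt k (punc D t') = rot a *m Rvec p.
  by rewrite isom_act_ptM gR isom_act_pt_rot.
apply/(VsetP HD); exists k; split => //.
  by rewrite isom_act_ptM g0 isom_act_pt_rot mulmx0.
have [s qs sq] := Rvec_tile q; have tt' := is_patch_tile HD patchP Pt'.
have qk : src q (isom_act_set k t') by apply: kP; exists t'.
rewrite -sq (sep (src q) s _ (Omega_src q) qs qk) ?punc_isom //.
rewrite sq kR -(subrKA (Rvec p)); apply: le_lt_trans (ler_fnormD _ _) _.
rewrite (splitr r) ltrD //; first by rewrite fnorm_distrC.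
rewrite fnorm_distrC -[X in _ *m _ - X]mul1mx -mulmxBl.
apply: le_lt_trans (ler_fnormM _ _) _; rewrite RpN.
rewrite (@le_lt_trans _ _ (fnorm (rot a - 1%:M) * (N + 1))) -?ltr_pdivlMr //.
by rewrite ler_wpM2l ?fnorm_ge0 // lerDl.
Qed.

Definition proto_tilings : set (tiles R) :=
  [set T | Omega D T /\ exists i : 'I_(nproto D), T (proto i)].

(* A patch is the image of a patch in the same orbit under an isometry, which is
   determined by the tile that it moves onto a proto-tile. *)
Lemma proto_patches_finite r : 0 < r ->
  (forall i : 'I_(nproto D), proto i `<=` eball 0 r) ->
  finite_set [set patch_in_ball T 0 r | T in proto_tilings].
Proof.
move=> r0 protor; set S := [set patch_in_ball _ _ _ | _ in _].
have S_orbits : S `<=` \bigcup_(O in [set isom_orbit Q | Q in patches D r])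
    [set Q | S Q /\ isom_orbit Q = O].
  move=> _ [T [OT iT] <-]; exists (isom_orbit (patch_in_ball T 0 r)).
    by exists (patch_in_ball T 0 r) => //; exists T, 0.
  by split => //; exists T.
apply: sub_finite_set S_orbits _.
apply: bigcup_finite => [|O _]; first exact: FLC.
have [->|/set0P[Q0 [SQ0 OQ0]]] := eqVneq [set Q | S Q /\ isom_orbit Q = O] set0.
  exact: finite_set0.
have S_images : [set Q | S Q /\ isom_orbit Q = O] `<=`
    \bigcup_(i in [set: 'I_(nproto D)]) \bigcup_(s in Q0)
    [set isom_act g Q0 | g in [set g | isom_act_set g s = proto i]].
  move=> Q [SQ OQ]; have [g _ gQ] : isom_orbit Q0 Q.
    by rewrite OQ0 -OQ; exists (isom1 R); rewrite ?isom_act1.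
  have [T [OT [i Ti]] QE] := SQ; have : Q (proto i) by rewrite -QE; split.
  by rewrite -{1}gQ => -[s Q0s si]; exists i => //; exists s => //; exists g.
apply: sub_finite_set S_images _.
apply: bigcup_finite => [|i _]; first exact: finite_finset.
have [T0 [OT0 _] Q0E] := SQ0; apply: bigcup_finite => [|s].
  by rewrite -Q0E; exact: (patch_in_ball_finite HD).
rewrite -Q0E => -[T0s _]; apply: subset1_finite => _ _ [g gs <-] [h hs <-].
apply: eq_isom_act; apply: (tile_isom_inj HD (Omega_tile HD OT0 T0s)).
by rewrite gs hs.
Qed.

Lemma tiling_limit T : (forall t, T t -> is_tile D t) ->
  (forall r,
     exists2 S, Omega D S & patch_in_ball S 0 r = patch_in_ball T 0 r) ->
  tiling T.
Proof.
move=> tT approx; have [M M0 outer] := outer_radius HD.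
have ball_eq S r t : patch_in_ball S 0 r = patch_in_ball T 0 r -> is_tile D t ->
    fnorm (punc D t) + M <= r -> S t <-> T t.
  move=> ST tt tr; have t_in : t `<=` eball 0 r.
    by apply: subset_trans (outer t tt) _; apply: subset_eball; rewrite subr0.
  split=> t_mem; first by have : patch_in_ball S 0 r t by []; rewrite ST => -[].
  by have : patch_in_ball T 0 r t by []; rewrite -ST => -[].
split.
- have -> : T = \bigcup_n patch_in_ball T 0 n%:R.
    apply/seteqP; split=> [t Tt|t [n _ []] //].
    exists (Num.truncn (fnorm (punc D t) + M)).+1 => //; split => //.
    apply: subset_trans (outer t (tT t Tt)) _; apply: subset_eball.
    by rewrite subr0; exact/ltW/truncnS_gt.
  apply: bigcup_countable => // n _; have [S OS <-] := approx n%:R.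
  exact/finite_set_countable/(patch_in_ball_finite HD).
- by move=> t /tT[g [i ->]]; exact/polygon_isom/(proto_polygon HD).
- apply/seteqP; split=> // y _; have [S OS ST] := approx (fnorm y + M + M).
  have [[_ _ covS _] _] := OS; have : setT y by []; rewrite -covS => -[t St ty].
  have tt := Omega_tile HD OS St.
  exists t => //; apply/(ball_eq S _ t ST) => //.
  have := ler_fnormD y (punc D t - y); rewrite addrC subrK fnorm_distrC lerD2r.
  by have := outer t tt y ty; rewrite /eball /=; lra.
- move=> s t Ts Tt.
  have [S OS ST] :=
    approx (Num.max (fnorm (punc D s) + M) (fnorm (punc D t) + M)).
  have [[_ _ _ disjS] _] := OS; apply: disjS; apply/(ball_eq S _ _ ST) => //.
  + exact: tT.
  + by rewrite le_max lexx.
  + exact: tT.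
  + by rewrite le_max lexx orbT.
Qed.

Lemma Omega_ultralimit (X : Type) (F : set_system X) (N : X -> tiles R) :
  UltraFilter F -> (forall x, proto_tilings (N x)) ->
  exists2 T, proto_tilings T &
    forall r, F [set x | patch_in_ball (N x) 0 r = patch_in_ball T 0 r].
Proof.
move=> UF protoN; have [M M0 outer] := outer_radius HD.
have proto_ball (i : 'I_(nproto D)) : proto i `<=` eball 0 M.
  by rewrite -(punc_proto0 HD i); apply: outer; exact: is_tile_proto.
pose T : tiles R := [set t | F [set x | N x t]].
have limit_patch_large r : M <= r ->
    F [set x | patch_in_ball (N x) 0 r = patch_in_ball T 0 r].
  move=> Mr; have [||Q _ FQ] :=
    @ultra_finite_choice _ _ F (fun x => patch_in_ball (N x) 0 r)
    [set patch_in_ball S 0 r | S in proto_tilings].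
  - apply: proto_patches_finite => [|i]; first exact: lt_le_trans Mr.
    apply: subset_trans (proto_ball i) _.
    by apply: subset_eball; rewrite subrr fnorm0 add0r.
  - by apply: filterS filterT => x _; exists (N x).
  apply: (filterS _ FQ) => x /= ->; apply/seteqP; split=> [t Qt|t [Tt tr]].
    split; last by have [y yQ] := filter_ex FQ; move: Qt; rewrite -yQ => -[].
    by apply: (filterS _ FQ) => y /= yQ; move: Qt; rewrite -yQ => -[].
  by have [y [/= Nyt <-]] := filter_ex (filterI (Tt : F _) FQ).
have limit_patch r : F [set x | patch_in_ball (N x) 0 r = patch_in_ball T 0 r].
  have Mr : M <= Num.max r M by rewrite le_max lexx orbT.
  apply: filterS (limit_patch_large _ Mr) => x.
  by apply: patch_in_ball_restrict; rewrite subrr fnorm0 add0r le_max lexx.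
have ON x : Omega D (N x) by have [] := protoN x.
exists T => //; split.
  have approx r :
      exists2 S, Omega D S & patch_in_ball S 0 r = patch_in_ball T 0 r.
    by have [x xT] := filter_ex (limit_patch r); exists (N x).
  apply: hull_limit => //; apply: tiling_limit => // t Tt.
  by have [x Nxt] := filter_ex (Tt : F _); exact: (Omega_tile HD (ON x)).
have [x xT] := filter_ex (limit_patch M).
have [_ [i Ni]] := protoN x; exists i.
have : patch_in_ball (N x) 0 M (proto i) by split.
by rewrite xT => -[].
Qed.

Lemma angle0_itv T : [set` `[0, 2 * pi]] (angle0 D T).
Proof.
rewrite /= in_itv /= /angle0 /tile_angle.
case: xgetP => [a _ [/andP[a0 a2] _]|_].
  by rewrite a0 ltW.
by rewrite lexx mulr_ge0 // pi_ge0.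
Qed.

Lemma rot_ultra_cvg (X : Type) (F : set_system X) (f : X -> tiles R) :
  UltraFilter F -> exists c, forall e, 0 < e ->
    F [set x | fnorm (rot c - rot (angle0 D (f x))) < e].
Proof.
move=> UF; have [|c _ fc] :=
  ultra_cvg_compact (f := angle0 D \o f) UF (@segment_compact R 0 (2 * pi)).
  by apply: filterS filterT => x _; exact: angle0_itv.
by exists c => e e0; exact: fc (rot_continuous c e0).
Qed.

Definition unrotated p : tiles R := isom_act (0, - angle0 D (src p)) (src p).

Definition unrotated_vec p : plane R := rot (- angle0 D (src p)) *m Rvec p.

Lemma src_unrotated p : src p = isom_act (0, angle0 D (src p)) (unrotated p).
Proof.
rewrite /unrotated -isom_actM -[LHS]isom_act1; apply: eq_isom_act => y.
by rewrite isom_act_pt1 isom_act_ptM !isom_act_pt_rot rotNK.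
Qed.

Lemma Rvec_unrotated p : Rvec p = rot (angle0 D (src p)) *m unrotated_vec p.
Proof. by rewrite rotNK. Qed.

Lemma unrotated_proto p : proto_tilings (unrotated p).
Proof.
have [S0 s0] := tile0P HD (Omega_punc_src p).
have [i iE] := unrotate_tile HD (tile0_is_tile HD (Omega_punc_src p)) s0.
split; first exact: Omega_isom (Omega_src p).
by exists i; exists (tile0 (src p)).
Qed.

Lemma unrotated_vec_tile p :
  exists2 t, unrotated p t & punc D t = unrotated_vec p.
Proof.
have [t pt tp] := Rvec_tile p; exists (isom_act_set (0, - angle0 D (src p)) t).
  by exists t.
rewrite punc_isom //; last exact: (Omega_tile HD (Omega_src p) pt).
by rewrite tp isom_act_pt_rot.
Qed.

Lemma dR_rotated p q S T a b v d : 0 < d -> d < 1 ->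
  fnorm (rot a - rot b) < d ->
  patch_in_ball S 0 d^-1 = patch_in_ball T 0 d^-1 ->
  src p = isom_act (0, a) S -> Rvec p = rot a *m v ->
  src q = isom_act (0, b) T -> Rvec q = rot b *m v ->
  dR p q <= d * (1 + fnorm v).
Proof.
move=> d0 d1 ab ST pS pv qT qv.
rewrite /dR pS qT pv qv -mulmxBl mulrDr mulr1 lerD //.
  exact: dGamma_rotate.
by apply: le_trans (ler_fnormM _ _) _; rewrite ler_wpM2r ?fnorm_ge0 // ltW.
Qed.

Lemma unrotated_ultralimit r (F : set_system (Rpunc D)) : UltraFilter F ->
  F [set p | fnorm (Rvec p) <= r] -> exists T t c,
  [/\ proto_tilings T, T t, F [set p | unrotated_vec p = punc D t],
      (forall k : R,
         F [set p | patch_in_ball (unrotated p) 0 k = patch_in_ball T 0 k]) &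
      (forall e, 0 < e ->
         F [set p | fnorm (rot c - rot (angle0 D (src p))) < e])].
Proof.
move=> UF Fr; have [M M0 outer] := outer_radius HD.
have [T [OT iT] FT] := Omega_ultralimit UF unrotated_proto.
have [c Fc] := rot_ultra_cvg (@src R D) UF.
have [||_ [t [Tt _] <-] Fv] := @ultra_finite_choice _ _ F unrotated_vec
  (punc D @` patch_in_ball T 0 (r + M)); last by exists T, t, c.
- exact/finite_image/(patch_in_ball_finite HD).
- apply: filterS (filterI Fr (FT (r + M))) => p [/= pr <-].
  have [t pt tp] := unrotated_vec_tile p; exists t => //; split => //.
  apply: subset_trans (outer t (Omega_tile HD (unrotated_proto p).1 pt)) _.
  by apply: subset_eball; rewrite subr0 lerD2r tp fnorm_rot.
Qed.

Lemma Rvec_ball_compact r : compact [set p : Rpunc D | fnorm (Rvec p) <= r].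
Proof.
rewrite compact_ultra => F UF Fr.
have [T [t [c [[OT [i Ti]] Tt Fv FT Fc]]]] := unrotated_ultralimit UF Fr.
set v := punc D t in Fv.
have OcT : Omega_punc D (isom_act (0, c) T).
  apply: (Omega_punc_isom HD OT Ti).
  by rewrite (punc_proto0 HD) isom_act_pt_rot mulmx0.
have [|p0 [p0T p0v]] := Rpunc_of_tile HD OcT (t := isom_act_set (0, c) t).
  by exists t.
have tt := Omega_tile HD OT Tt.
rewrite (punc_isom HD) // isom_act_pt_rot -/v in p0v; exists p0; split.
  have [p [/= pr pv]] := filter_ex (filterI Fr Fv).
  by rewrite /= p0v fnorm_rot -pv fnorm_rot.
apply: cvg_dR => e e0; have v2 : 0 < fnorm v + 2 by rewrite ltr_wpDl ?fnorm_ge0.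
pose d := Num.min 2^-1 (e / (fnorm v + 2)).
have d0 : 0 < d by rewrite lt_min invr_gt0 ltr0n divr_gt0.
have d1 : d < 1 by rewrite gt_min invf_lt1 ?ltr1n.
apply: filterS (filterI (filterI (Fc d d0) (FT d^-1)) Fv) => q [[/= qc qT] qv].
have := dR_rotated d0 d1 qc (esym qT) p0T p0v (src_unrotated q).
rewrite -qv -Rvec_unrotated => /(_ erefl)/le_lt_trans; apply.
rewrite (@lt_le_trans _ _ (d * (fnorm v + 2))) //.
  by rewrite qv ltr_pM2l // addrC ltrD2l ltr1n.
by rewrite -ler_pdivlMr // ge_min lexx orbT.
Qed.

End Compactness.

(** * The functions [efun] and [zfun] *)

Section UnitCircle.
Local Open Scope complex_scope.
Variable R : realType.
Implicit Types a b : R.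

Lemma eq_expi a b : rot a = rot b -> expi a = expi b.
Proof. by move=> /rot_eqP[cab sab]; rewrite /expi cab sab. Qed.

Lemma expi0 : expi 0 = 1 :> R[i].
Proof. by rewrite /expi cos0 sin0. Qed.

Lemma expiD a b : expi (a + b) = expi a * expi b.
Proof.
by rewrite /expi cosD sinD; apply/eqP; rewrite eq_complex /= eqxx addrC eqxx.
Qed.

Lemma norm_expi a : `|expi a| = 1.
Proof. by rewrite normc_def /= cos2Dsin2 sqrtr1. Qed.

Lemma expi_neq0 a : expi a != 0.
Proof. by rewrite -normr_eq0 norm_expi oner_eq0. Qed.

Lemma expiN a : expi (- a) = (expi a)^-1.
Proof.
by apply: (mulfI (expi_neq0 a)); rewrite mulfV ?expi_neq0 // -expiD addrN expi0.
Qed.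

Lemma conj_expi a : (expi a)^* = (expi a)^-1.
Proof. by rewrite -expiN /expi cosN sinN. Qed.

Lemma expiMz (k : int) a : expi (k%:~R * a) = expi a ^ k.
Proof.
have expiMn n : expi (n%:R * a) = expi a ^+ n.
  elim: n => [|n IH]; first by rewrite mul0r expi0.
  by rewrite exprS -IH -expiD -natr1 mulrDl mul1r addrC.
case: k => n; first exact: expiMn.
by rewrite NegzE mulrNz mulNr expiN expiMn.
Qed.

Lemma norm_expiB1 a : `|expi a - 1| <= (fnorm (rot a - 1%:M))%:C.
Proof.
rewrite normc_def lecR -rot0 /fnorm !big_ord_recl !big_ord0 ler_wsqrtr //.
rewrite !mxE /=.
have := sqr_ge0 (cos a - 1); have := sqr_ge0 (sin a); rewrite cos0 sin0; lra.
Qed.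

End UnitCircle.

Section Convolution.
Local Open Scope complex_scope.
Variables (R : realType) (D : tiling_data R) (HD : standing D).
Implicit Types (T : tiles R) (p q : Rpunc D) (f g : Rpunc D -> R[i]).
Implicit Types (c : tiles R -> R[i]).

Lemma RvalueE f p : Rvalue f (src p) (tgt p) = f p.
Proof. by rewrite /Rvalue /src /tgt -surjective_pairing valK. Qed.

Lemma Rvalue_factors f g p q1 q2 : Rfactors q1 q2 p ->
  Rvalue f (src p) (tgt q1) * Rvalue g (tgt q1) (tgt p) = f q1 * g q2.
Proof. by move=> [s1 t1s2 t2]; rewrite -s1 RvalueE t1s2 -t2 RvalueE. Qed.

Lemma Rclass_factors p T : Rclass D (src p) T ->
  exists q1 q2, Rfactors q1 q2 p /\ tgt q1 = T.
Proof.
move=> RT; have [//|q2 fp] := Rfactors_exists HD (q1 := Rpair RT) (p := p).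
by exists (Rpair RT), q2.
Qed.

Lemma convolution_eq1 f g p q1 q2 : Rfactors q1 q2 p ->
  (forall r1 r2, Rfactors r1 r2 p -> f r1 * g r2 != 0 -> r1 = q1) ->
  convolution f g p = f q1 * g q2.
Proof.
move=> fp unique; rewrite -(Rvalue_factors f g fp).
rewrite /convolution -(fsbig_widen [set tgt q1]) ?fsbig_set1 //.
  by move=> _ ->; have [<- _ _] := fp; exact: Rpunc_set_src_tgt.
move=> _ [/Rclass_factors[r1 [r2 [rp <-]]] /= r1q1].
rewrite (Rvalue_factors f g rp); apply/eqP; apply: contrapT => /negP.
by move=> /(unique _ _ rp) r1E; apply: r1q1; rewrite r1E.
Qed.

Lemma convolution_eq0 f g p :
  (forall q1 q2, Rfactors q1 q2 p -> f q1 * g q2 = 0) -> convolution f g p = 0.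
Proof.
move=> fg0; apply: fsbig1 => T /Rclass_factors[q1 [q2 [fp <-]]].
by rewrite (Rvalue_factors f g fp) fg0.
Qed.

Lemma involutionE f p : involution f p = (f (Rinv HD p))^*.
Proof. by rewrite /involution -(RvalueE f (Rinv HD p)). Qed.

Definition diagf c p : R[i] := if src p == tgt p then c (src p) else 0.

Definition scale_src c f p : R[i] := c (src p) * f p.

Lemma convolution_diagl c f : convolution (diagf c) f = scale_src c f.
Proof.
apply/funext => p; have OT := Omega_punc_src p.
rewrite (@convolution_eq1 _ _ p (Runit HD OT) p) // => [|r1 r2 [s1 _ _]].
  by rewrite /diagf eqxx.
rewrite /diagf; case: (src r1 =P tgt r1) => [st1 _|_].
  by apply: Rpunc_ext => //; rewrite -st1.
by rewrite mul0r eqxx.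
Qed.

Lemma convolution_diagr f c p : convolution f (diagf c) p = f p * c (tgt p).
Proof.
have OT := Omega_punc_tgt HD p.
rewrite (@convolution_eq1 _ _ p p (Runit HD OT)) // => [|r1 r2 [s1 t1s2 t2]].
  by rewrite /diagf eqxx.
rewrite /diagf; case: (src r2 =P tgt r2) => [st2 _|_].
  by apply: Rpunc_ext => //; rewrite t1s2 st2.
by rewrite mulr0 eqxx.
Qed.

Lemma scale_src_diagf c1 c2 :
  scale_src c1 (diagf c2) = diagf (fun T => c1 T * c2 T).
Proof.
by apply/funext => p; rewrite /scale_src /diagf; case: ifP; rewrite ?mulr0.
Qed.

Lemma involution_diagf c : involution (diagf c) = diagf (fun T => (c T)^*).
Proof.
apply/funext => p; rewrite involutionE /diagf src_inv tgt_inv eq_sym.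
by case: (src p =P tgt p) => [->|_] //; rewrite conjc0.
Qed.

Lemma upow_diagf c (k : int) : (forall T, (c T)^* = (c T)^-1) ->
  upow (diagf c) k = diagf (fun T => c T ^ k).
Proof.
move=> unitary; have iterE b n :
    iter n (convolution (diagf b)) (@diag_fun R D) = diagf (fun T => b T ^+ n).
  elim: n => [|n IH].
    apply/funext => p; rewrite /diagf /= /diag_fun indicE; case: eqP => st.
      by rewrite mem_set.
    by rewrite memNset.
  rewrite iterS IH convolution_diagl scale_src_diagf.
  by congr diagf; apply/funext => T; rewrite exprS.
case: k => n; first exact: iterE.
rewrite /upow involution_diagf iterE; congr diagf; apply/funext => T.
by rewrite unitary NegzE exprVn.
Qed.

Lemma convolution_scale_src c1 c2 c f g :
  (forall q, f q != 0 -> c2 (tgt q) = c (src q)) ->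
  convolution (scale_src c1 f) (scale_src c2 g) =
  scale_src (fun T => c1 T * c T) (convolution f g).
Proof.
move=> c2E; apply/funext => p; rewrite /scale_src /convolution mulr_fsumr.
apply: eq_fsbigr => T /set_mem/Rclass_factors[q1 [q2 [fp <-]]].
rewrite !(Rvalue_factors _ _ fp); have [-> <- _] := fp; have [s1 _ _] := fp.
have [->|/c2E ->] := eqVneq (f q1) 0; first by rewrite mulr0 !mul0r mulr0.
by rewrite s1 -!mulrA; congr (_ * _); rewrite mulrCA.
Qed.

End Convolution.

Section Generators.
Local Open Scope complex_scope.
Variables (R : realType) (D : tiling_data R) (HD : standing D).
Implicit Types (T P : tiles R) (t : set (plane R)) (p q : Rpunc D).
Implicit Types (f : Rpunc D -> R[i]).

Lemma continuous_dR f : (forall p (e : R), 0 < e ->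
    exists2 d, 0 < d & forall q, dR p q < d -> `|f p - f q| < e%:C) ->
  continuous (f : Rpunc D -> (R[i] : numFieldType)).
Proof.
move=> fcont; apply/continuousP => A oA; rewrite open_dRE => p Ap.
have /nbhs_ballP[[e e'] /= + eA] := open_nbhs_nbhs (conj oA Ap).
rewrite ltcE /= => /andP[/eqP e'0 e0]; have [d d0 pd] := fcont p e e0.
by exists d => // q /pd pq; apply: eA; rewrite /ball /= e'0.
Qed.

Lemma Cc_stable_support f r :
  continuous (f : Rpunc D -> (R[i] : numFieldType)) ->
  dR_stable [set p | f p != 0] ->
  (forall p, f p != 0 -> fnorm (Rvec p) <= r) -> Cc f.
Proof.
move=> fcont /dR_stable_closed closed_supp fr; split => //.
rewrite -(closure_id _).1 //.
exact: (subclosed_compact closed_supp (@Rvec_ball_compact _ _ HD r)).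
Qed.

Lemma efunE P t t' p : efun D P t t' p = (`[< Vset P t t' p >])%:R.
Proof. by rewrite /efun indicE. Qed.

Lemma efun_neq0 P t t' p : efun D P t t' p != 0 <-> Vset P t t' p.
Proof. by rewrite efunE pnatr_eq0 eqb0 negbK; split=> [/asboolP|/asboolP]. Qed.

Lemma efun_Cc P t t' : is_patch D P -> P t -> P t' -> Cc (efun D P t t').
Proof.
move=> patchP Pt Pt'; have stab := Vset_dR_stable HD patchP Pt Pt'.
apply: (@Cc_stable_support _ (fnorm (punc D t' - punc D t))).
- have [d d0 near] := stab; apply: continuous_dR => p e e0; exists d => // q pq.
  have Vpq : Vset P t t' p <-> Vset P t t' q.
    by split; apply: near; rewrite // dRC.
  by rewrite !efunE (propext Vpq) subrr normr0 ltcR.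
- rewrite (_ : [set p | _] = Vset P t t') //.
  by apply/seteqP; split=> p /efun_neq0.
- by move=> p /efun_neq0/(Vset_fnorm_Rvec HD) ->.
Qed.

Definition phase0 T : R[i] := expi (angle0 D T).

Lemma zfun_diagf : zfun D = diagf phase0.
Proof. by []. Qed.

Lemma upow_zfun (k : int) : upow (zfun D) k = diagf (fun T => phase0 T ^ k).
Proof. by apply: (upow_diagf HD) => T; exact: conj_expi. Qed.

Lemma zfun_neq0 p : zfun D p != 0 <-> src p = tgt p.
Proof.
rewrite /zfun; case: (src p =P tgt p) => st; last by rewrite eqxx.
by split=> // _; exact: expi_neq0.
Qed.

Lemma zfun_Cc : Cc (zfun D).
Proof.
have stab := diag_dR_stable HD; apply: (@Cc_stable_support _ 0).
- have [d d0 near] := stab; apply: continuous_dR => p e e0.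
  have [d' d'0 close] := dGamma_lt_rotation HD 0 e0.
  exists (Num.min d d'); first by rewrite lt_min d0.
  move=> q; rewrite lt_min => /andP[pq /dR_lt[pq' _]].
  have -> : zfun D q = if src p == tgt p then phase0 (src q) else 0.
    rewrite /zfun; congr (if _ then _ else _).
    by apply/eqP/eqP; apply: near; rewrite // dRC.
  rewrite /zfun; case: ifPn => [_|_]; last by rewrite subrr normr0 ltcR.
  have [a ae carry] := close _ _ (Omega_punc_src p) (Omega_punc_src q) pq'.
  have [S0 s0] := tile0P HD (Omega_punc_src p).
  have qE : rot (angle0 D (src q)) = rot (a + angle0 D (src p)).
    apply: (angle0_isom HD (g := (0, a))) (Omega_src q) _ _.
    + exact/(tile0_is_tile HD)/Omega_punc_src.
    + by apply: carry; rewrite // s0 fnorm0.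
    + by rewrite s0 isom_act_pt_rot mulmx0.
  rewrite /phase0 (eq_expi qE) expiD -/(angle0 D (src p)).
  rewrite -{1}[expi (angle0 _ _)]mul1r -mulrBl normrM norm_expi mulr1 distrC.
  by apply: le_lt_trans (norm_expiB1 a) _; rewrite ltcR.
- rewrite (_ : [set p | _] = [set p | src p = tgt p]) //.
  by apply/seteqP; split=> p /zfun_neq0.
- by move=> p /zfun_neq0/(Rvec_eq0 HD) ->; rewrite fnorm0.
Qed.

Lemma involution_efun P t t' : involution (efun D P t t') = efun D P t' t.
Proof.
apply/funext => p; rewrite (involutionE HD) !efunE conjc_nat.
congr (nat_of_bool _)%:R.
by apply/asboolP/asboolP => /(Vset_inv HD).
Qed.

Lemma phase0_Vset P t t' p : is_tile D t -> is_tile D t' -> P t -> P t' ->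
  Vset P t t' p ->
  phase0 (tgt p) = phase0 (src p) * expi (tile_angle D t' - tile_angle D t).
Proof.
move=> tt tt' Pt Pt' Vp; rewrite /phase0 -expiD.
exact/eq_expi/(Vset_angle0 HD tt tt' Pt Pt' Vp).
Qed.

Lemma zfun_efun_commute P t t' : is_tile D t -> is_tile D t' -> P t -> P t' ->
  convolution (zfun D) (efun D P t t') =
  expi (tile_angle D t - tile_angle D t')
    \*o convolution (efun D P t t') (zfun D).
Proof.
move=> tt tt' Pt Pt'; apply/funext => p /=.
rewrite zfun_diagf (convolution_diagl HD) (convolution_diagr HD) /scale_src.
have [->|/efun_neq0 Vp] := eqVneq (efun D P t t' p) 0.
  by rewrite mul0r !mulr0.
rewrite (phase0_Vset tt tt' Pt Pt' Vp) mulrC mulrCA; congr (_ * _).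
by rewrite mulrCA -expiD addrA subrK subrr expi0 mulr1.
Qed.

Lemma convolution_efun P1 P2 t1 t t2 : is_tile D t1 -> is_tile D t ->
  P1 t1 -> P1 t -> P2 t ->
  convolution (efun D P1 t1 t) (efun D P2 t t2) = efun D (P1 `|` P2) t1 t2.
Proof.
move=> tt1 tt P1t1 P1t P2t; apply/funext => p.
have [Vp|nVp] := pselect (Vset (P1 `|` P2) t1 t2 p).
  have [q1 [q2 [fp V1 V2]]] := Vset_factor HD tt P1t Vp.
  rewrite (convolution_eq1 HD fp) ?efunE ?asboolT ?mulr1 // => r1 r2 [s1 _ _].
  rewrite mulf_eq0 negb_or => /andP[/efun_neq0 W1 _].
  by apply: (Vset_inj HD tt1 P1t1) W1 V1; have [-> _ _] := fp.
rewrite [RHS]efunE asboolF //; apply: (convolution_eq0 HD) => q1 q2 fp.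
apply/eqP; apply: contrapT => /negP; rewrite mulf_eq0 negb_or.
move=> /andP[/efun_neq0 V1 /efun_neq0 V2].
by apply: nVp; exact: (Vset_mul HD tt P1t P2t fp).
Qed.

Lemma convolution_upow_zfun_efun P1 P2 t1 t t2 (k l : int) :
  is_tile D t1 -> is_tile D t -> P1 t1 -> P1 t -> P2 t ->
  convolution (convolution (upow (zfun D) k) (efun D P1 t1 t))
              (convolution (upow (zfun D) l) (efun D P2 t t2)) =
  expi (l%:~R * (tile_angle D t - tile_angle D t1))
    \*o convolution (upow (zfun D) (k + l)) (efun D (P1 `|` P2) t1 t2).
Proof.
move=> tt1 tt P1t1 P1t P2t; rewrite !upow_zfun !(convolution_diagl HD).
pose w := expi (tile_angle D t - tile_angle D t1).
have phase0_tgt q : efun D P1 t1 t q != 0 ->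
    phase0 (tgt q) ^ l = phase0 (src q) ^ l * w ^ l.
  by move=> /efun_neq0/(phase0_Vset tt1 tt P1t1 P1t) ->; rewrite expfzMl.
rewrite (@convolution_scale_src _ _ HD _ (fun T => phase0 T ^ l)
  (fun T => phase0 T ^ l * w ^ l)) //.
rewrite convolution_efun //; apply/funext => p /=.
rewrite /scale_src expiMz expfzDr ?expi_neq0 // -/w.
move: (_ ^ k) (phase0 _ ^ l) (w ^ l) (efun _ _ _ _ _) => zk zl wl e; ring.
Qed.

End Generators.

Theorem lemma3p2 (R : realType) (D : tiling_data R) (HD : standing D) :
  [/\ Cc (zfun D),
      (forall (P : tiles R) (t t' : set (plane R)),
         is_patch D P -> P t -> P t' ->
         [/\ Cc (efun D P t t'),
             involution (efun D P t t') = efun D P t' t &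
             convolution (zfun D) (efun D P t t') =
               expi (tile_angle D t - tile_angle D t')
                 \*o convolution (efun D P t t') (zfun D)]) &
      (forall (P1 P2 : tiles R) (t1 t1' t2 t2' : set (plane R)),
         is_patch D P1 -> is_patch D P2 ->
         P1 t1 -> P1 t1' -> P2 t2 -> P2 t2' -> t1' = t2 -> agree P1 P2 ->
         convolution (efun D P1 t1 t1') (efun D P2 t2 t2') =
           efun D (P1 `|` P2) t1 t2' /\
         forall k l : int,
           convolution (convolution (upow (zfun D) k) (efun D P1 t1 t1'))
                       (convolution (upow (zfun D) l) (efun D P2 t2 t2')) =
             expi (l%:~R * (tile_angle D t2 - tile_angle D t1))
               \*o convolution (upow (zfun D) (k + l))
                               (efun D (P1 `|` P2) t1 t2'))].
Proof.
split; first exact: zfun_Cc.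
- move=> P t t' patchP Pt Pt'; split.
  + exact: efun_Cc.
  + exact: involution_efun.
  + by apply: zfun_efun_commute => //; exact: is_patch_tile patchP _.
- move=> P1 P2 t1 t1' t2 t2' patchP1 _ P1t1 P1t1' P2t2 _ t12 _; subst t2.
  have tt1 := is_patch_tile HD patchP1 P1t1.
  have tt1' := is_patch_tile HD patchP1 P1t1'.
  split; first exact: convolution_efun.
  by move=> k l; exact: convolution_upow_zfun_efun.
Qed.
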